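(* Assume $d\ge 3$ and let $q$ be real with $q>\frac{d}{d-2}$. Then there are constants $c_2^-(q,d)>0$ and $c_2^+(q,d)>0$ such that for every $\xi\ge 1$ and all $n$ large enough, $$\exp\left(-c_2^-(q,d)\,(\xi n)^{1/q}\right)\le P\left( \|l_n\|_q^q-E[\|l_n\|_q^q]\ge \xi n\right)\le \exp\left(-c_2^+(q,d)\,(\xi n)^{1/q}\right).$$ Moreover, for every $\xi\ge 1$, $$\limsup_{\epsilon\to 0}\ \limsup_{n\to\infty}\ \frac{1}{n^{1/q}}\log P\left(\sum_{z\in \mathbb{Z}^d}\mathbf{1}_{\{l_n(z)<\epsilon n^{1/q}\}}\,l_n(z)^q\ge E[\|l_n\|_q^q]+\xi n\right)=-\infty,$$ where $\epsilon\to0$ through positive values.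
   Context: $\{S(n),\ n\in\mathbb{N}\}$ is the simple (nearest-neighbour, symmetric) random walk on $\mathbb{Z}^d$ started at the origin, with law $P$ and expectation $E$. Its local times are $l_n(z)=\sum_{k=0}^{n-1}\mathbf{1}_{\{S(k)=z\}}$ for $z\in\mathbb{Z}^d$, and $\|l_n\|_q^q=\sum_{z\in\mathbb{Z}^d} l_n(z)^q$. Convention: $\log 0=-\infty$. *)

(* Defs.v *)
From HB Require Import structures.
From mathcomp Require Import all_boot all_order all_algebra.
From mathcomp Require Import finmap.
From mathcomp Require Import all_classical all_reals all_analysis.
Import Order.TTheory GRing.Theory Num.Theory.
Import numFieldNormedType.Exports.

Set Implicit Arguments.
Unset Strict Implicit.
Unset Printing Implicit Defensive.

Local Open Scope classical_set_scope.
Local Open Scope ring_scope.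

(* V carries its discrete sigma-algebra, so all its subsets are events; V is
   only used for the countable group Z^d. *)
Definition discrete_rv (disp : measure_display) (T : measurableType disp)
    (V : Type) (X : T -> V) : Prop :=
  forall A : set V, measurable (X @^-1` A).

Definition mutually_independent (disp : measure_display)
    (T : measurableType disp) (R : realType) (P : probability T R)
    (V : Type) (X : nat -> T -> V) : Prop :=
  forall (I : {fset nat}) (A : nat -> set V),
    P (\bigcap_(k in [set` I]) (X k @^-1` A k)) =
    (\prod_(k <- I) P (X k @^-1` A k))%E.

Definition origin_neighbour (d : nat) (z : 'rV[int]_d) : bool :=
  (\sum_(i < d) `|z ord0 i| == 1)%N.

Definition step (T : Type) (d : nat) (S : nat -> T -> 'rV[int]_d) (k : nat)
    (w : T) : 'rV[int]_d :=
  S k.+1 w - S k w.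

Record simple_random_walk (disp : measure_display) (T : measurableType disp)
    (R : realType) (P : probability T R) (d : nat)
    (S : nat -> T -> 'rV[int]_d) : Prop := SimpleRandomWalk {
  srw_rv : forall k, discrete_rv (S k);
  srw_start : forall w, S 0%N w = 0;
  srw_step : forall k z, P (step S k @^-1` [set z]) =
    (if origin_neighbour z then (d.*2%:R)^-1 else 0)%:E;
  srw_indep : mutually_independent P (step S)
}.

Definition local_time (T : Type) (d : nat) (S : nat -> T -> 'rV[int]_d)
    (n : nat) (z : 'rV[int]_d) (w : T) : nat :=
  (\sum_(0 <= k < n) (S k w == z))%N.

(* The sums over Z^d below have finite support when 0 < q, because l_n
   vanishes outside the n first sites visited and 0 `^ q = 0. *)
Definition norm_q_pow (R : realType) (T : Type) (d : nat)
    (S : nat -> T -> 'rV[int]_d) (q : R) (n : nat) (w : T) : R :=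
  \sum_(z \in [set: 'rV[int]_d]) (local_time S n z w)%:R `^ q.

Definition low_norm_q_pow (R : realType) (T : Type) (d : nat)
    (S : nat -> T -> 'rV[int]_d) (q b : R) (n : nat) (w : T) : R :=
  \sum_(z \in [set: 'rV[int]_d])
    \1_[set y | (local_time S n y w)%:R < b] z * (local_time S n z w)%:R `^ q.

(* Main.v *)
(** The site carrying the walk at time [k] revisits a set of [K] sites that
grows along the path with exponential tails on the scale [K^(2/d)], once the
potential brought in by each growth is discounted; this supermartingale bound
only uses the heat kernel estimate [p_k(z) <= C k^(-d/2)], which makes the
potential of any [K] sites at most [C K^(2/d)].

Let [D_t] be the set of sites visited at least [t] times.  Sites of [D_2t] are
visited [t] times after entering [D_t], so [|D_2t|] is unlikely to be large when
[|D_t|] is not.  Climbing the rungs [t = t0 2^j], from the trivial bound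
[|D_t| <= n], gives [|D_t| <= L_t] for suitable [L_t] decaying faster than
[t^(-q)], with a failure probability
[exp (- t L_t^(1 - 2/d))]: as [q (1 - 2/d) > 1], the worst rung is the top one,
[t ~ (xi n)^(1/q)], and stopping at [eps n^(1/q)] improves the rate by a negative
power of [eps].

Below a constant level [A], the sum over sites is compared with the sum over
time blocks of constant length: the blocks are i.i.d. and bounded, their sum is at
most [||l_n||_q^q] by superadditivity, and few sites are shared between blocks, by
the same supermartingale bound.  The lower bound comes from a walk oscillating
between 0 and a neighbour. *)
Require Import Defs.
From HB Require Import structures.
From mathcomp Require Import all_boot all_order all_algebra.
From mathcomp Require Import finmap.
From mathcomp Require Import all_classical all_reals all_analysis.
From mathcomp Require Import measurable_realfun.
From mathcomp Require Import ring lra zify.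
Import Order.TTheory GRing.Theory Num.Theory.
Import numFieldNormedType.Exports.

Local Open Scope classical_set_scope.
Local Open Scope ring_scope.

(** * Averages along the walk *)

(** The deviation is measured from the exact mean, whereas the occupation bounds only control
    multiples of [n]. Since [xi n >= n/2 + xi n/2], the rarely visited sites get [n/2] and the
    others [xi n/2]. The second share needs no centering: raising the level [A] makes the bound
    below the failure events an arbitrarily small multiple of [n]. The first share does; the means
    of the block sums lie below the exact mean, so only upper fluctuations matter. Its failure rate
    [n^(1 - 2/d)] beats [n^(1/q)] by the same inequality [q (1 - 2/d) > 1] that rules the ladder.

    Half of the room in that inequality is spent on a slack [eta]: [L_t] has one term of exponent
    [q + eta] and one of exponent [q - eta], so that both parts of the sum of [t^q L_t] over the
    rungs are geometric and no logarithm is lost.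

    All estimates concern finite averages over step choices, with the past kept as a list and time
    measured by what remains. A supermartingale is then a one-step inequality, and the probability
    space enters only at the end. *)

Section Walk.
Context {R : realType} {V : zmodType} (N : seq V).

Definition avg (f : V -> R) : R := (size N)%:R^-1 * \sum_(e <- N) f e.

(* The walk is at [x] and [h] lists the sites occupied before, latest first. *)
Fixpoint walk_mean (n : nat) (f : V -> seq V -> R) (x : V) (h : seq V) : R :=
  if n is m.+1 then avg (fun e => walk_mean m f (x + e) (x :: h)) else f x h.

(** The transition probability [p_k(z, 0)], with no first-passage condition; its partial sums
    [green] are the Green function truncated at time [m], so all potentials are finite sums. *)
Fixpoint hit_prob (k : nat) (z : V) : R :=
  if k is k'.+1 then avg (fun e => hit_prob k' (z + e)) else (z == 0)%:R.

Definition green (m : nat) (z : V) : R := \sum_(k < m) hit_prob k z.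

Lemma avgD f g : avg (fun e => f e + g e) = avg f + avg g.
Proof. by rewrite /avg big_split mulrDr. Qed.

Lemma avgZ c f : avg (fun e => c * f e) = c * avg f.
Proof. by rewrite /avg -mulr_sumr mulrCA. Qed.

Lemma avg_sum (I : Type) (s : seq I) (F : I -> V -> R) :
  avg (fun e => \sum_(i <- s) F i e) = \sum_(i <- s) avg (F i).
Proof. by rewrite /avg exchange_big mulr_sumr. Qed.

Lemma eq_avg f g : f =1 g -> avg f = avg g.
Proof. by move=> fg; congr (_ * _); apply: eq_bigr => e _. Qed.

Lemma avg_le f g : (forall e, f e <= g e) -> avg f <= avg g.
Proof.
by move=> fg; apply: ler_wpM2l; [rewrite invr_ge0|apply: ler_sum].
Qed.

Lemma avg_ge0 f : (forall e, 0 <= f e) -> 0 <= avg f.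
Proof. by move=> f0; rewrite mulr_ge0 ?invr_ge0 ?sumr_ge0. Qed.

Hypothesis N_gt0 : (0 < size N)%N.

Lemma avg_cst c : avg (fun=> c) = c.
Proof.
rewrite /avg big_const_seq count_predT iter_addr_0 -[c *+ _]mulr_natl mulrA mulVf ?mul1r//.
by rewrite pnatr_eq0 -lt0n.
Qed.

Lemma walk_mean_le n f g x h :
  (forall y h', size h' = (n + size h)%N -> f y h' <= g y h') ->
  walk_mean n f x h <= walk_mean n g x h.
Proof.
elim: n x h => [|n IH] x h fg /=; first exact: fg.
by apply: avg_le => e; apply: IH => y h' /= sh'; apply: fg; rewrite sh' addnS.
Qed.

Lemma eq_walk_mean n f g x h :
  (forall y h', size h' = (n + size h)%N -> f y h' = g y h') ->
  walk_mean n f x h = walk_mean n g x h.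
Proof.
by move=> fg; apply/eqP; rewrite eq_le !walk_mean_le// => y h' /fg ->.
Qed.

Lemma walk_mean_cst n c x h : walk_mean n (fun _ _ => c) x h = c.
Proof.
by elim: n x h => // n IH x h /=; rewrite -[RHS]avg_cst; apply: eq_avg => e.
Qed.

Lemma walk_mean_ge0 n f x h : (forall y h', 0 <= f y h') -> 0 <= walk_mean n f x h.
Proof.
by move=> f0; rewrite -(walk_mean_cst n 0 x h); apply: walk_mean_le => *; exact: f0.
Qed.

Lemma walk_meanD n f g x h :
  walk_mean n (fun y h => f y h + g y h) x h = walk_mean n f x h + walk_mean n g x h.
Proof.
by elim: n x h => // n IH x h /=; rewrite -avgD; apply: eq_avg => e.
Qed.

Lemma walk_meanZ n c f x h :
  walk_mean n (fun y h => c * f y h) x h = c * walk_mean n f x h.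
Proof.
by elim: n x h => // n IH x h /=; rewrite -avgZ; apply: eq_avg => e.
Qed.

Lemma walk_mean_comp m n f x h :
  walk_mean (m + n) f x h = walk_mean m (walk_mean n f) x h.
Proof.
by elim: m x h => // m IH x h /=; apply: eq_avg => e.
Qed.

(** Markov property with translation invariance: with [y = 0] and [g] empty, the walk going on from
    [x] with past [h] is a fresh walk moved by [x], its sites put in front of [h]. General [y] and
    [g] serve the induction. *)
Lemma walk_mean_shift n f x h y g :
  walk_mean n f (y + x) ([seq z + x | z <- g] ++ h) =
  walk_mean n (fun y g => f (y + x) ([seq z + x | z <- g] ++ h)) y g.
Proof.
by elim: n y g => // n IH y g /=; apply: eq_avg => e; rewrite addrAC -IH.
Qed.

(** [M] is indexed by the time left, so the induction follows the recursion of [walk_mean], which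
    averages over the first step outermost. *)
Lemma walk_mean_supermartingale (M : nat -> V -> seq V -> R) n x h :
  (forall m y h', avg (fun e => M m (y + e) (y :: h')) <= M m.+1 y h') ->
  walk_mean n (M 0%N) x h <= M n x h.
Proof.
move=> superM; elim: n x h => // n IH x h /=.
by apply: le_trans (superM _ _ _); apply: avg_le.
Qed.

Lemma walk_mean_markov n (A : V -> seq V -> bool) (f : V -> seq V -> R) (c : R) x h :
  0 < c -> (forall y h', 0 <= f y h') ->
  (forall y h', size h' = (n + size h)%N -> A y h' -> c <= f y h') ->
  walk_mean n (fun y h => (A y h)%:R) x h <= c^-1 * walk_mean n f x h.
Proof.
move=> c0 f0 cf; rewrite -walk_meanZ; apply: walk_mean_le => y h' sh'.
case: (boolP (A y h')) => [/cf|_]; last by apply: mulr_ge0 => //; rewrite invr_ge0 ltW.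
by move=> /(_ sh') cfy; rewrite mulrC ler_pdivlMr ?mul1r.
Qed.

Lemma hit_prob_ge0 k z : 0 <= hit_prob k z.
Proof. by elim: k z => [|k IH] z /=; [rewrite ler0n|apply: avg_ge0]. Qed.

Lemma green_ge0 m z : 0 <= green m z.
Proof. by rewrite sumr_ge0// => k _; exact: hit_prob_ge0. Qed.

Lemma greenS m z : green m.+1 z = (z == 0)%:R + avg (fun e => green m (z + e)).
Proof.
rewrite /green big_ord_recl /= avg_sum; congr (_ + _).
Qed.

Lemma sum_sub_eq0 (x : V) (s : seq V) : uniq s -> \sum_(z <- s) (x - z == 0)%:R = (x \in s)%:R :> R.
Proof.
elim: s => [|a s IH] /=; first by rewrite big_nil.
case/andP=> ans us; rewrite big_cons IH// subr_eq0 in_cons.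
by case: eqP => [->|_]; rewrite ?(negbTE ans) /= ?addr0 ?add0r.
Qed.

Lemma sum_hit_prob_le1 k (x : V) (s : seq V) : uniq s -> \sum_(z <- s) hit_prob k (x - z) <= 1.
Proof.
move=> us; elim: k x => [|k IH] x /=.
  by rewrite sum_sub_eq0// lern1 leq_b1.
rewrite -avg_sum -[leRHS](avg_cst 1); apply: avg_le => e.
by under eq_bigr do rewrite addrAC; exact: IH.
Qed.

(* Along the walk, [1 + 2 lam U] with [U] the potential of the visited set
   decreases by [2 lam] at each visit and increases by at most [2 lam b] when
   the set grows; both are absorbed by the exponential weight. *)
Lemma weighted_visits (W : seq V -> R) (L : seq V -> seq V)
    (b : V -> seq V -> R) (lam : R) n x h :
  0 <= lam -> (forall h, 0 <= W h) -> (forall h, uniq (L h)) ->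
  (forall x h, 0 <= b x h) ->
  (forall m y h, 0 < W h -> 2 * lam * \sum_(z <- L h) green m (y - z) <= 1) ->
  (forall x h, 0 < W (x :: h) -> 0 < W h) ->
  (forall x h, 0 < W (x :: h) ->
    W (x :: h) * expR (2 * lam * b x h) <= W h * expR (lam * (x \in L h)%:R)) ->
  (forall m y x h, 0 < W (x :: h) ->
    \sum_(z <- L (x :: h)) green m (y - z) <=
    \sum_(z <- L h) green m (y - z) + b x h) ->
  walk_mean n (fun _ h => W h) x h <= 2 * W h.
Proof.
move=> lam0 W0 uL b0 small Wc Wstep Lstep.
pose U m y g := \sum_(z <- L g) green m (y - z).
have U0 m y g : 0 <= U m y g by apply: sumr_ge0 => z _; exact: green_ge0.
pose M m y g := W g * (1 + 2 * lam * U m y g).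
apply: (@le_trans _ _ (M n x h)); last first.
  rewrite /M; have := W0 h; rewrite le_eqVlt => /orP[/eqP<-|Wh]; first by rewrite mul0r mulr0.
  rewrite mulrC ler_pM2r//; have := small n x h Wh; rewrite -/(U n x h); lra.
have -> : walk_mean n (fun _ h => W h) x h = walk_mean n (M 0%N) x h.
  apply: eq_walk_mean => y g _; rewrite /M /U.
  by rewrite big1 ?mulr0 ?addr0 ?mulr1// => z _; rewrite /green big_ord0.
apply: walk_mean_supermartingale => m y g; rewrite /M avgZ.
have := W0 (y :: g); rewrite le_eqVlt => /orP[/eqP<-|Wyg].
  by rewrite mul0r mulr_ge0 ?W0// addr_ge0// !mulr_ge0.
have Wg := Wc _ _ Wyg.
set v : R := (y \in L g)%:R.
(* First-step decomposition: a visit to the set lowers the mean of its potential by exactly 1. *)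
have UE : avg (fun e => U m (y + e) g) = U m.+1 y g - v.
  rewrite /U avg_sum; under [in RHS]eq_bigr do rewrite greenS.
  rewrite big_split/= addrAC.
  rewrite sum_sub_eq0// -/v.
  rewrite subrr add0r; apply: eq_bigr => z _; apply: eq_avg => e.
  by rewrite addrAC.
have UE0 : 0 <= U m.+1 y g - v by rewrite -UE; exact: avg_ge0.
set H := 1 + 2 * lam * U m.+1 y g.
have lamUv := mulr_ge0 lam0 UE0.
set B := 2 * lam * b y g.
have B0 : 0 <= B by rewrite !mulr_ge0.
have H2 : H <= 2 by have := small m.+1 y g Wg; rewrite -/(U m.+1 y g) /H; lra.
apply: (@le_trans _ _ (W (y :: g) * (H - 2 * lam * v + B))).
  apply: ler_wpM2l => //.
  apply: (@le_trans _ _ (avg (fun e => (1 + B) + 2 * lam * U m (y + e) g))).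
    apply: avg_le => e; have := Lstep m (y + e) y g Wyg.
    rewrite -!/(U _ _ _) => /(ler_wpM2l lam0); rewrite /B; lra.
  by rewrite avgD avg_cst avgZ UE /H; lra.
have v1 : 0 <= v <= 1 by rewrite ler0n lern1 leq_b1.
have H1 : 1 <= H - 2 * lam * v by rewrite /H; lra.
apply: (@le_trans _ _ (W (y :: g) * ((H - 2 * lam * v) * expR B))).
  (* The base is at least 1, so adding [B] is dominated by multiplying with [1 + B], hence with
     [expR B]. *)
  apply: ler_wpM2l => //; apply: (@le_trans _ _ ((H - 2 * lam * v) * (1 + B))); last first.
    by apply: ler_wpM2l; [lra|exact: expR_ge1Dx].
  by have := mulr_ge0 (_ : 0 <= H - 2 * lam * v - 1) B0; rewrite subr_ge0 => /(_ H1); lra.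
rewrite mulrCA mulrC.
apply: (@le_trans _ _ (W g * expR (lam * v) * (H - 2 * lam * v))).
  by apply: ler_wpM2r; [lra|exact: Wstep].
rewrite -mulrA; apply: ler_wpM2l => //.
have lv0 : 0 <= lam * v by rewrite mulr_ge0//; lra.
(* [H - 2 lam v <= H (1 - lam v)] follows from [H <= 2]. This is why the potential has coefficient
   2: the loss [2 lam v] outweighs the gain [expR (lam v)] of the weight even when [H] is as large
   as 2. *)
have : expR (lam * v) * (H - 2 * lam * v) <= expR (lam * v) * (H * expR (- (lam * v))).
  apply: ler_wpM2l; first exact: expR_ge0.
  apply: (@le_trans _ _ (H * (1 + - (lam * v)))).
    have := mulr_ge0 lv0 (_ : 0 <= 2 - H); rewrite subr_ge0 => /(_ H2); lra.
  by apply: ler_wpM2l; [lra|exact: expR_ge1Dx].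
by rewrite mulrCA expRxMexpNx_1 mulr1.
Qed.

End Walk.

(** * Heat kernel and Green function *)
Lemma bin_le_central m l : ('C(m.*2, l) <= 'C(m.*2, m))%N.
Proof.
have low k : (k <= m)%N -> ('C(m.*2, m - k) <= 'C(m.*2, m))%N.
  elim: k => [|k IH] km; first by rewrite subn0.
  apply: leq_trans (IH (ltnW km)).
  have -> : (m - k = (m - k.+1).+1)%N by lia.
  rewrite -(@leq_pmul2l (m - k.+1).+1)// mul_bin_left.
  by apply: leq_mul => //; lia.
have [lm|ml] := leqP l m; first by rewrite -(subKn lm); apply: low; rewrite leq_subr.
have [lm2|ml2] := leqP l m.*2; last by rewrite bin_small.
rewrite -bin_sub// (_ : m.*2 - l = m - (l - m))%N; last by lia.
by apply: low; lia.
Qed.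

(** Integer form of [C(2m, m) <= 4^m / sqrt(2m + 1)]. Consecutive central coefficients have ratio
    [2 (2m + 1) / (m + 1)], and the induction closes because [(2m + 1)(2m + 3) <= (2m + 2)^2]. *)
Lemma central_bin_le m : ('C(m.*2, m) ^ 2 * m.*2.+1 <= 16 ^ m)%N.
Proof.
elim: m => // m IH.
have E : (m.+1 * 'C(m.+1.*2, m.+1) = m.*2.+1.*2 * 'C(m.*2, m))%N.
  apply/eqP; rewrite -(@eqn_pmul2l m.+1)// doubleS -(mul_bin_diag m.*2.+2 m) /=.
  have := mul_bin_down m.*2.+1 m; rewrite /= (_ : m.*2.+1 - m = m.+1)%N; last by lia.
  rewrite mulnCA => <-; apply/eqP.
  have -> : (m.*2.+2 = m.+1 * 2)%N by lia.
  by rewrite -(mulnA m.+1 2) [(2 * _)%N]mulnA mul2n.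
rewrite -(@leq_pmul2l (m.+1 ^ 2))// mulnA -expnMn E expnMn (expnS 16).
set e := (_.*2 ^ 2)%N; set a := ('C(_, _) ^ 2)%N.
have h : (e * m.+1.*2.+1 <= m.+1 ^ 2 * 16 * m.*2.+1)%N.
  have k : (m.*2.+1 * m.+1.*2.+1 <= 4 * m.+1 ^ 2)%N by rewrite -mulnn; lia.
  have -> : e = (4 * m.*2.+1 * m.*2.+1)%N by rewrite /e -mulnn; lia.
  rewrite -mulnA; apply: leq_trans (leq_mul (leqnn _) k) _.
  by move: (m.*2.+1) (m.+1 ^ 2)%N => c f; lia.
rewrite mulnAC; apply: leq_trans (leq_mul h (leqnn a)) _.
rewrite -!mulnA leq_mul2l; apply/orP; right; rewrite leq_mul2l; apply/orP; right.
by rewrite leq_mul2l /= mulnC.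
Qed.

Lemma bin_sq_le j l : ('C(j, l) ^ 2 * j.+1 <= 4 * 4 ^ j)%N.
Proof.
have E m : (16 ^ m = 4 ^ m.*2)%N by rewrite -muln2 mulnC expnM.
set m := j./2.
have H : ('C(j, l) <= 2 ^ odd j * 'C(m.*2, m))%N.
  have [j1|j0] := boolP (odd j); last first.
    by rewrite mul1n (_ : j = m.*2) ?bin_le_central// /m; lia.
  have {1}-> : j = m.*2.+1 by rewrite /m; lia.
  case: l => [|l]; first by rewrite bin0 muln_gt0/= bin_gt0; lia.
  by rewrite binS expn1 mul2n -[X in (_ <= X)%N]addnn leq_add// bin_le_central.
apply: (@leq_trans ((2 ^ odd j * 'C(m.*2, m)) ^ 2 * (2 ^ odd j * m.*2.+1))).
  by apply: leq_mul; [rewrite leq_exp2r|have := odd_double_half j; rewrite -/m; case: (odd j)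
    => /= Ej; rewrite ?expn1 ?expn0; lia].
rewrite expnMn mulnACA -expnSr.
apply: leq_trans (leq_mul (leqnn _) (central_bin_le m)) _.
rewrite E -expnM; have {2}-> : j = (odd j + m.*2)%N by rewrite /m; lia.
by rewrite expnD mulnA leq_mul2r; case: (odd j); rewrite ?orbT.
Qed.

Section Binomial.
Variable R : realType.

Lemma sum_binS (F : nat -> R) k :
  \sum_(l < k.+2) 'C(k.+1, l)%:R * F l = \sum_(l < k.+1) 'C(k, l)%:R * (F l + F l.+1).
Proof.
under [RHS]eq_bigr do rewrite mulrDr.
rewrite big_split/= big_ord_recl /= bin0.
under eq_bigr do rewrite /bump /= add1n binS natrD mulrDl.
rewrite big_split /= addrA; congr (_ + _).
rewrite [RHS]big_ord_recl bin0; congr (_ + _).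
by rewrite big_ord_recr /= bin_small// mul0r addr0.
Qed.

(** Each use of [C(k, j) (k + 1) = C(k + 1, j) (k + 1 - j)] trades a factor [1 / (k - j + 1)] for a
    factor [1 / (k + 1)] and a larger upper index, up to a constant. The weights then disappear into
    a binomial expansion. *)
Lemma bin_div_le i : exists2 A : R, 0 < A & forall k j, (j <= k)%N ->
  'C(k, j)%:R / (k - j).+1%:R ^+ i <= A * 'C(k + i, j)%:R / k.+1%:R ^+ i.
Proof.
elim: i => [|i [A A0 IH]].
  by exists 1 => // k j jk; rewrite !expr0 !divr1 mul1r addn0.
exists (2 ^+ i * A); first by rewrite mulr_gt0// exprn_gt0.
move=> k j jk.
have -> : 'C(k, j)%:R / (k - j).+1%:R ^+ i.+1 =
    'C(k.+1, j)%:R / (k.+1%:R * (k - j).+1%:R ^+ i) :> R.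
  have E : ('C(k, j)%:R * k.+1%:R = 'C(k.+1, j)%:R * (k - j).+1%:R :> R).
    rewrite -!natrM; congr (_%:R); have := mul_bin_down k.+1 j.
    by rewrite subSn//= mulnC => ->; rewrite mulnC.
  by rewrite exprS; apply/eqP; rewrite eqr_div ?mulf_neq0 ?expf_neq0 ?pnatr_eq0// !mulrA E.
rewrite addnS -addSn.
have H := IH k.+1 j (leqW jk); rewrite subSn// in H.
have y0 : 0 < k.+1%:R :> R by rewrite ltr0n.
have x0 : 0 < (k - j).+1%:R :> R by rewrite ltr0n.
have yy' : k.+1%:R <= k.+2%:R :> R by rewrite ler_nat.
have xx' : (k - j).+2%:R <= 2 * (k - j).+1%:R :> R by rewrite -natrM ler_nat; lia.
have x'0 : 0 < (k - j).+2%:R :> R by rewrite ltr0n.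
move: H y0 x0 yy' xx' x'0.
have : 0 <= A * 'C(k.+1 + i, j)%:R by rewrite mulr_ge0// ltW.
have : 0 <= 'C(k.+1, j)%:R :> R by [].
rewrite -[2 ^+ i * A * _]mulrA; move: (A * _) ('C(_, _)%:R) => D c.
move: (k.+1%:R : R) ((k - j).+1%:R : R) (k.+2%:R : R) ((k - j).+2%:R : R).
move=> y x y' x' c0 D0 H y0 x0 yy' xx' x'0.
rewrite exprS invfM [(y * _)^-1]invfM !mulrA ![_ / y]mulrC -!mulrA.
rewrite ler_pM2l ?invr_gt0//.
apply: (@le_trans _ _ (2 ^+ i * (c / x' ^+ i))).
  rewrite mulrCA ler_wpM2l// -[leLHS]mul1r ler_pdivrMr ?exprn_gt0// mulrAC -exprMn.
  rewrite ler_pdivlMr ?exprn_gt0// mul1r; apply: lerXn2r => //; rewrite nnegrE ltW//.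
  by rewrite mulr_gt0.
rewrite ler_pM2l ?exprn_gt0//; apply: le_trans H _; rewrite ler_wpM2l//.
rewrite lef_pV2 ?posrE ?exprn_gt0//; last exact: lt_le_trans yy'.
by apply: lerXn2r => //; rewrite nnegrE ltW//; exact: lt_le_trans yy'.
Qed.

End Binomial.
Section HeatKernel.
Variable R : realType.
Local Notation rt k := (Num.sqrt (k.+1%:R : R)).

Lemma rt_gt0 k : 0 < rt k.
Proof. by rewrite sqrtr_gt0 ltr0n. Qed.

Lemma rt_sq k i : (rt k ^+ i) ^+ 2 = k.+1%:R ^+ i.
Proof. by rewrite exprAC sqr_sqrtr. Qed.

(** The induction step in the dimension. In place of concentration of the binomial law, the
    inequality [u <= th/2 u^2 + 1/(2 th)], with [th] the inverse of the target order, replaces the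
    square roots by the rational weights [v j]; raising the indices of the binomial coefficients
    absorbs these. *)
Lemma bin_convolution_le i : (0 < i)%N -> exists2 B : R, 0 < B & forall k,
  \sum_(j < k.+1) 'C(k, j)%:R * (i%:R ^+ (k - j) / (rt j * rt (k - j) ^+ i)) <=
  B * i.+1%:R ^+ k / rt k ^+ i.+1.
Proof.
move=> i0; have [A A0 HA] := bin_div_le R i.
set D : R := A * i.+1%:R ^+ i.+1.
have D0 : 0 < D by rewrite mulr_gt0// exprn_gt0// ltr0n.
exists ((D + 1) / 2); first by rewrite divr_gt0// addr_gt0.
move=> k; set th := rt k ^+ i.+1.
have th0 : 0 < th by rewrite exprn_gt0// rt_gt0.
have th2 : th ^+ 2 = k.+1%:R ^+ i.+1 by rewrite rt_sq.
pose w (j : nat) : R := 'C(k, j)%:R * i%:R ^+ (k - j).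
pose v (j : nat) : R := (j.+1%:R * (k - j).+1%:R ^+ i)^-1.
have w0 j : 0 <= w j by rewrite mulr_ge0// exprn_ge0.
have sumw : \sum_(j < k.+1) w j = i.+1%:R ^+ k.
  rewrite -natr1 exprDn; apply: eq_bigr => j _.
  by rewrite expr1n mulr1 -mulr_natl.
have sumwv : \sum_(j < k.+1) w j * v j <= D * i.+1%:R ^+ k / th ^+ 2.
  rewrite th2; set K := (k.+1 + i)%N.
  have bnd (j : 'I_k.+1) : w j * v j <=
      A / k.+1%:R ^+ i.+1 * ('C(K, j.+1)%:R * i%:R ^+ (K - j.+1)).
    have jk : (j <= k)%N by rewrite -ltnS.
    have e1 : i%:R ^+ (k - j) <= i%:R ^+ (K - j.+1) :> R.
      by rewrite ler_weXn2l ?ler1n//; rewrite /K; lia.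
    have e2 : 'C(k + i, j)%:R / j.+1%:R <= 'C(K, j.+1)%:R / k.+1%:R :> R.
      have := mul_bin_diag K j; rewrite /K addSn /= => /(congr1 (fun n => n%:R : R)).
      rewrite !natrM => e; rewrite ler_pdivrMr ?ltr0n// mulrAC ler_pdivlMr ?ltr0n//.
      rewrite [leRHS]mulrC -e mulrC; apply: ler_wpM2r => //.
      by rewrite ler_nat ltnS leq_addr.
    rewrite /w /v invfM.
    apply: (@le_trans _ _ (i%:R ^+ (k - j) * (j.+1%:R^-1 * (A * 'C(k + i, j)%:R / k.+1%:R ^+ i)))).
      have sh (c p a b : R) : c * p * (a * b) = p * (a * (c * b)) by ring.
      rewrite sh ler_wpM2l ?exprn_ge0// ler_wpM2l ?invr_ge0//; exact: HA.
    rewrite exprS [(_ * k.+1%:R ^+ i)^-1]invfM.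
    have sh1 (p a c y : R) : p * (a * (A * c * y)) = p * (A * y * (c * a)) by ring.
    have sh2 (p a c y : R) : A * (a * y) * (c * p) = p * (A * y * (c * a)) by ring.
    rewrite sh1 sh2; apply: ler_pM e1 _ => //; rewrite ?exprn_ge0//.
      by rewrite !mulr_ge0 ?invr_ge0 ?exprn_ge0// ltW.
    by rewrite ler_wpM2l// mulr_ge0 ?invr_ge0 ?exprn_ge0// ltW.
  apply: le_trans (ler_sum _ (fun j _ => bnd j)) _.
  have sh (a b e : R) : A * a * b * e = A * e * (b * a) by ring.
  rewrite -mulr_sumr /D sh.
  apply: ler_wpM2l; first by rewrite mulr_ge0 ?invr_ge0 ?exprn_ge0// ltW.
  rewrite -exprD (_ : (k + i.+1)%N = K); last by rewrite addnS.
  rewrite -[in leRHS]natr1 exprDn [in leRHS]big_ord_recl /=.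
  apply: (@le_trans _ _ (\sum_(j < K) 'C(K, j.+1)%:R * i%:R ^+ (K - j.+1))).
    have kK : (k.+1 <= K)%N by rewrite leq_addr.
    rewrite (big_ord_widen K (fun j : nat => 'C(K, j.+1)%:R * i%:R ^+ (K - j.+1) : R) kK).
    rewrite big_mkcond; apply: ler_sum => j _; case: ifP => //.
  rewrite -[leLHS]add0r; apply: lerD; first by rewrite mulrn_wge0// mulr_ge0 ?exprn_ge0.
  by apply: ler_sum => j _; rewrite /bump leq0n add1n expr1n mulr1 mulr_natl.
have term (j : 'I_k.+1) : 'C(k, j)%:R * (i%:R ^+ (k - j) / (rt j * rt (k - j) ^+ i)) <=
    th / 2 * (w j * v j) + (2 * th)^-1 * w j.
  set u := (rt j * rt (k - j) ^+ i)^-1.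
  have -> : v j = u ^+ 2.
    by rewrite /v /u exprVn exprMn sqr_sqrtr// rt_sq.
  have shf (a b c e : R) : a * (b * e) + c * b = b * (a * e + c) by ring.
  rewrite mulrA -/(w j) shf; apply: ler_wpM2l => //.
  rewrite -subr_ge0.
  have -> : th / 2 * u ^+ 2 + (2 * th)^-1 - u = (2 * th)^-1 * (th * u - 1) ^+ 2.
    by field; exact: lt0r_neq0.
  by rewrite mulr_ge0 ?sqr_ge0// invr_ge0 mulr_ge0// ltW.
apply: (@le_trans _ _ (\sum_(j < k.+1) (th / 2 * (w j * v j) + (2 * th)^-1 * w j))).
  by apply: ler_sum => j _; exact: term.
rewrite big_split /= -!mulr_sumr sumw.
apply: (@le_trans _ _ (th / 2 * (D * i.+1%:R ^+ k / th ^+ 2) + (2 * th)^-1 * i.+1%:R ^+ k)).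
  by rewrite lerD2r ler_wpM2l// divr_ge0// ltW.
by rewrite le_eqVlt; apply/orP; left; apply/eqP; field; exact: lt0r_neq0.
Qed.

End HeatKernel.
Section LatticeWalk.
Variables (R : realType) (d : nat).
Local Notation rt k := (Num.sqrt (k.+1%:R : R)).
Local Notation unitv c := (delta_mx ord0 c : 'rV[int]_d).

Definition lattice_steps : seq 'rV[int]_d :=
  [seq unitv c | c <- index_enum 'I_d] ++ [seq - unitv c | c <- index_enum 'I_d].

Lemma size_lattice_steps : size lattice_steps = d.*2.
Proof. by rewrite size_cat !size_map /index_enum -!enumT -!cardE card_ord addnn. Qed.

Fixpoint line_walks (j : nat) (x : int) : R :=
  if j is j'.+1 then line_walks j' (x + 1) + line_walks j' (x - 1) else (x == 0)%:R.

(* Walks of length [k] from [z] to 0 along the first [i] coordinate axes. *)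
Fixpoint axis_walks (i k : nat) (z : 'rV[int]_d) : R :=
  if k is k'.+1 then
    \sum_(c < d | (c < i)%N)
      (axis_walks i k' (z + unitv c) + axis_walks i k' (z - unitv c))
  else (z == 0)%:R.

Definition clear_coord (i : 'I_d) (z : 'rV[int]_d) : 'rV[int]_d :=
  \row_c (if c == i then 0 else z ord0 c).

Lemma line_walks_ge0 j x : 0 <= line_walks j x.
Proof. by elim: j x => [|j IH] x /=; rewrite ?addr_ge0. Qed.

Lemma axis_walks_ge0 i k z : 0 <= axis_walks i k z.
Proof.
by elim: k z => [|k IH] z //=; apply: sumr_ge0 => c _; rewrite addr_ge0.
Qed.

Lemma line_walksE j x :
  line_walks j x = \sum_(l < j.+1) 'C(j, l)%:R * (x == l.*2%:Z - j%:Z)%:R.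
Proof.
elim: j x => [|j IH] x /=.
  by rewrite big_ord1 bin0 mul1r subr0.
rewrite (sum_binS R (fun l : nat => (x == l.*2%:Z - j.+1%:Z)%:R)) !IH -big_split /=.
apply: eq_bigr => l _; rewrite -mulrDr; congr (_ * (_%:R + _%:R)); congr nat_of_bool; lia.
Qed.

Lemma line_walks_le j x : line_walks j x <= 2 * 2 ^+ j / rt j.
Proof.
have b l : 'C(j, l)%:R <= 2 * 2 ^+ j / rt j.
  rewrite ler_pdivlMr ?rt_gt0// -ler_sqr ?nnegrE ?mulr_ge0 ?exprn_ge0 ?sqrtr_ge0//.
  rewrite exprMn sqr_sqrtr// exprMn exprAC -!natrX -!natrM ler_nat; exact: bin_sq_le.
have [/existsP[l /eqP xl]|] := boolP [exists l : 'I_j.+1, x == l.*2%:Z - j%:Z].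
  rewrite line_walksE (bigD1 l)//= big1 ?addr0 => [|m ml].
    by rewrite xl eqxx mulr1.
  rewrite xl; case: eqP => [E|]; rewrite ?mulr0//.
  by case/eqP: ml; apply/val_inj => /=; lia.
rewrite negb_exists => /forallP h.
rewrite line_walksE big1 => [|l _]; last by rewrite (negbTE (h l)) mulr0.
by rewrite divr_ge0 ?mulr_ge0 ?exprn_ge0 ?sqrtr_ge0.
Qed.

Lemma clear_coordD i z y : clear_coord i (z + y) = clear_coord i z + clear_coord i y.
Proof. by apply/rowP => c; rewrite !mxE; case: eqP; rewrite ?addr0. Qed.

Lemma clear_coordN i z : clear_coord i (- z) = - clear_coord i z.
Proof. by apply/rowP => c; rewrite !mxE; case: eqP; rewrite ?oppr0. Qed.

Lemma clear_coord_unit i c : clear_coord i (unitv c) = if c == i then 0 else unitv c.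
Proof.
apply/rowP => b; rewrite !mxE /=; case: (c =P i) => [->|ci]; rewrite !mxE/=.
  by case: eqP.
by case: (b =P i) => [->|//]; rewrite eq_sym; case: eqP ci.
Qed.

(** A walk on the first [i + 1] axes shuffles a line walk with a walk on the first [i] axes, and the
    binomial coefficient counts the shuffles. This brings the heat kernel down to dimension one. *)
Lemma axis_walks_split (i : 'I_d) k z :
  axis_walks i.+1 k z =
  \sum_(j < k.+1) 'C(k, j)%:R * (line_walks j (z ord0 i) *
                                 axis_walks i (k - j) (clear_coord i z)).
Proof.
elim: k z => [|k IH] z.
  rewrite big_ord1 bin0 mul1r /= -natrM mulnb; congr (nat_of_bool _)%:R.
  apply/eqP/andP => [->|[/eqP zi /eqP cz]].
    by split; apply/eqP; [rewrite mxE|apply/rowP => c; rewrite !mxE if_same].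
  apply/rowP => c; rewrite mxE; move/rowP/(_ c): cz; rewrite !mxE.
  by case: eqP => [->|].
pose F j : R := line_walks j (z ord0 i) * axis_walks i (k.+1 - j) (clear_coord i z).
rewrite (sum_binS R F) /= (bigD1 i)//= addrC.
rewrite (eq_bigl (fun c : 'I_d => (c < i)%N)); last first.
  by move=> c; rewrite ltnS ltn_neqAle andbC.
rewrite (_ : axis_walks _ _ _ + axis_walks _ _ _ =
    \sum_(j < k.+1) 'C(k, j)%:R * F j.+1); last first.
  rewrite !IH -big_split /=; apply: eq_bigr => j _; rewrite -mulrDr; congr (_ * _).
  rewrite /F subSS /= mulrDl !clear_coordD clear_coordN clear_coord_unit eqxx oppr0 !addr0.
  by rewrite !mxE !eqxx.
under [RHS]eq_bigr do rewrite mulrDr.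
rewrite [RHS]big_split /=; congr (_ + _).
under eq_bigr do rewrite !IH -big_split /=.
rewrite exchange_big /=; apply: eq_bigr => j _.
rewrite /F subSn ?leq_ord//= !mulr_sumr; apply: eq_bigr => c ci.
have ic : (i == c) = false by apply/negbTE; rewrite -val_eqE /=; case: eqP ci => // ->;
  rewrite ltnn.
rewrite !clear_coordD clear_coordN clear_coord_unit eq_sym ic.
by rewrite !mxE /= ic/= oppr0 !addr0 -!mulrDr.
Qed.

Lemma axis_walks_le i : (0 < i <= d)%N -> exists2 C : R, 0 < C & forall k z,
  axis_walks i k z <= C * i.*2%:R ^+ k / rt k ^+ i.
Proof.
elim: i => // -[_ /= d0|i IH /= id].
  exists 2 => // k z; rewrite -[1%N]/((Ordinal d0 : 'I_d) : nat).+1 axis_walks_split.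
  rewrite big_ord_recr/= big1 ?add0r => [|j _]; last first.
    have jk : (0 < k - j)%N by rewrite subn_gt0.
    by case: (k - j)%N jk => // m _ /=; rewrite big_pred0 ?mulr0// => c; rewrite ltn0.
  rewrite binn mul1r subnn /= expr1; apply: le_trans _ (line_walks_le k (z ord0 (Ordinal d0))).
  by rewrite ler_piMr ?line_walks_ge0// lern1 leq_b1.
have [C C0 HC] := IH (ltnW id).
have [B B0 HB] := bin_convolution_le R i.+1 isT.
exists (2 * C * B); first by rewrite !mulr_gt0.
move=> k z; rewrite -[i.+2]/((Ordinal id : 'I_d) : nat).+1 axis_walks_split /=.
apply: (@le_trans _ _ (2 * C * 2 ^+ k * \sum_(j < k.+1) 'C(k, j)%:R *
    (i.+1%:R ^+ (k - j) / (rt j * rt (k - j) ^+ i.+1)))).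
  rewrite mulr_sumr; apply: ler_sum => j _.
  rewrite [leRHS]mulrCA; apply: ler_wpM2l => //.
  apply: (@le_trans _ _ (2 * 2 ^+ j / rt j *
      (C * i.+1.*2%:R ^+ (k - j) / rt (k - j) ^+ i.+1))).
    by apply: ler_pM; rewrite ?line_walks_ge0 ?axis_walks_ge0 ?line_walks_le.
  have -> : 2 ^+ k = 2 ^+ j * 2 ^+ (k - j) :> R by rewrite -exprD subnKC ?leq_ord.
  rewrite -mul2n natrM exprMn invfM.
  by rewrite le_eqVlt; apply/orP; left; apply/eqP; ring.
apply: (@le_trans _ _ (2 * C * 2 ^+ k * (B * i.+2%:R ^+ k / rt k ^+ i.+2))).
  by rewrite ler_wpM2l// !mulr_ge0 ?exprn_ge0// ltW.
rewrite -mul2n natrM exprMn.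
by rewrite le_eqVlt; apply/orP; left; apply/eqP; ring.
Qed.

Lemma hit_probE k z :
  hit_prob lattice_steps k z = (d.*2%:R ^+ k)^-1 * axis_walks d k z.
Proof.
elim: k z => [|k IH] z /=; first by rewrite invr1 mul1r.
rewrite /avg size_lattice_steps exprS invfM -mulrA; congr (_ * _).
rewrite mulr_sumr big_cat /= !big_map -big_split /=.
rewrite [RHS](eq_bigl xpredT) => [|c]; last by rewrite ltn_ord.
by apply: eq_bigr => c _; rewrite !IH mulrDr.
Qed.

Lemma heat_kernel_le : (0 < d)%N -> exists2 C : R, 0 < C & forall k z,
  hit_prob lattice_steps k z <= C / rt k ^+ d.
Proof.
move=> d0; have [|C C0 H] := axis_walks_le d; first by rewrite d0 leqnn.
exists C => // k z; rewrite hit_probE mulrC ler_pdivrMr.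
  by rewrite mulrAC; exact: H.
by rewrite exprn_gt0// ltr0n double_gt0.
Qed.

End LatticeWalk.
Section GreenBound.
Variable R : realType.

(** Comparison of [t^(-a-1)] with its integral in telescoping form; it comes down to
    [ln x <= ln (x + 1) - 1 / (x + 1)]. *)
Lemma powR_decr_step (x a : R) : 0 < x -> 0 < a ->
  a * (x + 1) `^ (- a - 1) <= x `^ (- a) - (x + 1) `^ (- a).
Proof.
move=> x0 a0; set y := x + 1.
have y0 : 0 < y by rewrite addr_gt0.
have lnx : ln x <= ln y - y^-1.
  have -> : x = y * (1 - y^-1) by rewrite /y; field; lra.
  have u1 : -1 < - y^-1 by rewrite ltrN2 invf_lt1// /y; lra.
  rewrite lnM ?posrE//; last lra.
  by rewrite lerD2l; exact: le_ln1Dx.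
rewrite powRD; last by rewrite (gt_eqF y0) implybT.
rewrite (powR_inv1 (ltW y0)) lerBrDl.
apply: (@le_trans _ _ (y `^ (- a) * expR (a * y^-1))); last first.
  rewrite /powR !gt_eqF// -expRD ler_expR.
  by have := ler_wpM2l (ltW a0) lnx; lra.
apply: (@le_trans _ _ (y `^ (- a) * (1 + a * y^-1))); first by rewrite mulrDr mulr1 mulrCA.
by rewrite ler_wpM2l ?powR_ge0// expR_ge1Dx.
Qed.

(** The two arguments of the minimum cross near [k = L^(1/(a+1))]. Before that time each term is at
    most 1; after it the tail telescopes to the same order. *)
Lemma sum_min_powR_le (a : R) : 0 < a -> forall (L : R) m, 1 <= L ->
  \sum_(k < m) Num.min 1 (L * k.+1%:R `^ (- a - 1)) <= (2 + a^-1) * L `^ (a + 1)^-1.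
Proof.
move=> a0 L m L1; set x := L `^ _.
have a1 : 0 < a + 1 by rewrite addr_gt0.
have L0 : 0 < L by exact: lt_le_trans L1.
have x1 : 1 <= x.
  have -> : 1 = 1 `^ (a + 1)^-1 :> R by rewrite powR1.
  by apply: ge0_ler_powR; rewrite ?nnegrE ?invr_ge0 ?(ltW a1) ?(ltW L0).
have x0 : 0 < x by exact: lt_le_trans x1.
pose f k : R := Num.min 1 (L * k.+1%:R `^ (- a - 1)).
have f0 k : 0 <= f k by rewrite le_min ler01 mulr_ge0 ?powR_ge0// ltW.
set k0 := (Num.truncn x).+1.
have xk0 : x <= k0%:R by apply/ltW/truncnS_gt.
have k0x : k0%:R <= 2 * x.
  have : (Num.truncn x)%:R <= x by rewrite truncn_le// ltW.
  by rewrite /k0 -natr1; lra.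
have k00 : 0 < k0%:R :> R by rewrite ltr0n.
have claim j : \sum_(k < k0 + j) f k <=
    k0%:R + L / a * (k0%:R `^ (- a) - (k0 + j)%:R `^ (- a)).
  elim: j => [|j IH].
    rewrite addn0 subrr mulr0 addr0.
    have -> : k0%:R = \sum_(k < k0) (1 : R) by rewrite sumr_const card_ord.
    by apply: ler_sum => k _; rewrite ge_min lexx.
  rewrite addnS big_ord_recr /=.
  have kj0 : 0 < (k0 + j)%:R :> R by rewrite ltr0n.
  have := powR_decr_step _ _ kj0 a0; rewrite natr1 => /(ler_wpM2l (_ : 0 <= L / a)).
  have La : 0 <= L / a by rewrite divr_ge0 ?ltW.
  move=> /(_ La); rewrite mulrA divfK ?gt_eqF// => h.
  have fl : f (k0 + j)%N <= L * (k0 + j).+1%:R `^ (- a - 1) by rewrite ge_min lexx orbT.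
  apply: le_trans (lerD IH (le_trans fl h)) _.
  by rewrite -addrA -mulrDr addrA subrK.
apply: (@le_trans _ _ (\sum_(k < k0 + m) f k)).
  rewrite (big_ord_widen (k0 + m) f (leq_addl _ _)) big_mkcond.
  by apply: ler_sum => k _; case: ifP.
apply: le_trans (claim m) _.
apply: (@le_trans _ _ (2 * x + L / a * k0%:R `^ (- a))).
  apply: lerD => //; apply: ler_wpM2l; first by apply: divr_ge0; exact: ltW.
  by rewrite gerBl powR_ge0.
rewrite [leRHS]mulrDl lerD2l -mulrA mulrCA; apply: ler_wpM2l; first by rewrite invr_ge0 ltW.
apply: (@le_trans _ _ (L * x `^ (- a))).
  apply: ler_wpM2l; first exact: ltW.
  rewrite !powRN lef_pV2 ?posrE ?powR_gt0//.
  by apply: ge0_ler_powR => //; rewrite ?nnegrE ltW.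
rewrite /x -powRrM -[X in X * _](powRr1 (ltW L0)) -powRD; last by rewrite (gt_eqF L0) implybT.
by rewrite le_eqVlt; apply/orP; left; apply/eqP; congr (_ `^ _); field; rewrite gt_eqF.
Qed.

(** At time [k] a set of [K] sites is hit with probability at most 1 and at most [C K k^(-d/2)].
    Summing the smaller bound, with [a + 1 = d/2], gives the exponent [2/d]; [2 < d] makes [a]
    positive. *)
Lemma green_sum_le d : (2 < d)%N -> exists2 C : R, 1 <= C &
  forall m x (s : seq 'rV[int]_d), uniq s ->
    \sum_(z <- s) green (lattice_steps d) m (x - z) <= C * (size s)%:R `^ (2 / d%:R).
Proof.
move=> d2; have d0 : (0 < d)%N by lia.
have [K K0 HK] := heat_kernel_le R d d0.
have dR : 2 < d%:R :> R by rewrite (ltr_nat _ 2).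
pose a : R := d%:R / 2 - 1; have a0 : 0 < a by rewrite /a; lra.
pose C := Num.max 1 K.
have C0 : 1 <= C by rewrite le_max lexx.
exists (C * (2 + a^-1)).
  by rewrite -[leLHS]mulr1; apply: ler_pM => //; have := invr_gt0 a; rewrite a0; lra.
move=> m x [|z0 s'] us; first by rewrite big_nil mulr_ge0 ?powR_ge0// mulr_ge0; have :=
  invr_gt0 a; rewrite a0; lra.
set s := z0 :: s'; set L : R := (size s)%:R.
have L1 : 1 <= L by rewrite ler1n.
have -> : 2 / d%:R = (a + 1)^-1 by rewrite /a; field; lra.
apply: (@le_trans _ _ (C * \sum_(k < m) Num.min 1 (L * k.+1%:R `^ (- a - 1)))); last first.
  by rewrite -mulrA ler_wpM2l ?sum_min_powR_le//; lra.
rewrite /green exchange_big mulr_sumr; apply: ler_sum => k _ /=.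
rewrite minr_pMr; last lra.
rewrite le_min mulr1; apply/andP; split.
  apply: le_trans _ C0; apply: sum_hit_prob_le1 => //.
  by rewrite size_lattice_steps double_gt0.
apply: (@le_trans _ _ (\sum_(z <- s) C * k.+1%:R `^ (- a - 1))); last first.
  by rewrite big_const_seq count_predT iter_addr_0 -[_ *+ size s]mulr_natl -/L; lra.
apply: ler_sum => z _; apply: le_trans (HK _ _) _.
rewrite (_ : - a - 1 = - (d%:R / 2)); last by rewrite /a; lra.
rewrite powRN (_ : k.+1%:R `^ (d%:R / 2) = Num.sqrt k.+1%:R ^+ d); last first.
  by rewrite -powR12_sqrt// -powR_mulrn ?powR_ge0// -powRrM mulrC.
by rewrite ler_wpM2r ?invr_ge0 ?exprn_ge0 ?sqrtr_ge0// le_max lexx orbT.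
Qed.

End GreenBound.

(** * Occupation levels *)
Section Occupation.
Context {R : realType} {V : zmodType}.

Definition occ_sum (phi : V -> nat -> R) (h : seq V) : R :=
  \sum_(z <- undup h) phi z (count_mem z h).

Lemma occ_sum_widen phi h s : (forall z, phi z 0%N = 0) -> uniq s -> {subset h <= s} ->
  occ_sum phi h = \sum_(z <- s) phi z (count_mem z h).
Proof.
move=> phi0 us hs; rewrite /occ_sum [RHS](bigID (mem h)) /=.
rewrite [X in _ + X]big1 ?addr0 => [|z zh]; last by rewrite (count_memPn zh).
rewrite -[RHS]big_filter; apply: perm_big; apply: uniq_perm.
- exact: undup_uniq.
- exact: filter_uniq.
- by move=> z; rewrite mem_undup mem_filter; case: (boolP (z \in h)) => // /hs ->.
Qed.

Lemma occ_sum_cons phi x h : (forall z, phi z 0%N = 0) ->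
  occ_sum phi (x :: h) =
  occ_sum phi h + (phi x (count_mem x h).+1 - phi x (count_mem x h)).
Proof.
move=> phi0; have us := undup_uniq (x :: h).
rewrite (occ_sum_widen _ (x :: h) (undup (x :: h)))//; last by move=> z; rewrite mem_undup.
rewrite (occ_sum_widen _ h (undup (x :: h)))//; last first.
  by move=> z zh; rewrite mem_undup in_cons zh orbT.
have xin : x \in undup (x :: h) by rewrite mem_undup mem_head.
rewrite !(bigD1_seq x)//= eqxx add1n.
rewrite [in RHS]addrAC addrCA subrr addr0; congr (_ + _).
by apply: eq_bigr => z zx; rewrite eq_sym (negbTE zx).
Qed.

Lemma occ_sum_le phi psi h : (forall z v, (0 < v <= size h)%N -> phi z v <= psi z v) ->
  occ_sum phi h <= occ_sum psi h.
Proof.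
move=> le; rewrite /occ_sum big_seq [leRHS]big_seq; apply: ler_sum => z.
by rewrite mem_undup => zh; apply: le; rewrite -has_count has_pred1 zh count_size.
Qed.

Lemma occ_sum_ge0 phi h : (forall z v, 0 <= phi z v) -> 0 <= occ_sum phi h.
Proof. by move=> p0; apply: sumr_ge0. Qed.

Definition level (t : nat) (h : seq V) : seq V :=
  [seq z <- undup h | (t <= count_mem z h)%N].

Lemma level_uniq t h : uniq (level t h).
Proof. exact/filter_uniq/undup_uniq. Qed.

Lemma mem_level t x h : (0 < t)%N -> (x \in level t h) = (t <= count_mem x h)%N.
Proof.
move=> t0; rewrite mem_filter mem_undup; case: (boolP (x \in h)) => [_|/count_memPn ->].
  by rewrite andbT.
by rewrite andbF leqNgt t0.
Qed.

Lemma sum_level t h (g : V -> R) :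
  \sum_(z <- level t h) g z = occ_sum (fun z v => (t <= v)%N%:R * g z) h.
Proof.
rewrite /level big_filter big_mkcond; apply: eq_bigr => z _.
by case: ifP; rewrite ?mul1r ?mul0r.
Qed.

Lemma size_level t h : (size (level t h))%:R = occ_sum (fun _ v => (t <= v)%N%:R) h :> R.
Proof.
rewrite -sum1_size natr_sum sum_level; apply: eq_bigr => z _; by rewrite mulr1.
Qed.

Lemma leq_natrB t c : (t <= c.+1)%N%:R - (t <= c)%N%:R = (t == c.+1)%:R :> R.
Proof.
by rewrite leq_eqVlt ltnS; case: eqP => [->|_] /=; rewrite ?ltnn ?subr0 ?subrr.
Qed.

Lemma sum_level_cons t x h (g : V -> R) : (0 < t)%N ->
  \sum_(z <- level t (x :: h)) g z =
  \sum_(z <- level t h) g z + (t == (count_mem x h).+1)%:R * g x.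
Proof.
move=> t0; rewrite !sum_level occ_sum_cons; last by move=> z; rewrite leqNgt t0 mul0r.
by rewrite -mulrBl leq_natrB.
Qed.

Lemma size_level_cons t x h : (0 < t)%N ->
  size (level t (x :: h)) = (size (level t h) + (t == (count_mem x h).+1))%N.
Proof.
move=> t0; apply/eqP; rewrite -(eqr_nat R) natrD !size_level occ_sum_cons => [|z].
  apply/eqP; congr (_ + _).
  exact: leq_natrB.
by rewrite leqNgt t0.
Qed.

(** The set is read off the past before each step, so the visit that brings a site into [L] is not
    counted. *)
Fixpoint visits (L : seq V -> seq V) (h : seq V) : nat :=
  if h is x :: h' then (visits L h' + (x \in L h'))%N else 0%N.

Lemma visits_level t h : (0 < t)%N ->
  (visits (level t) h)%:R = occ_sum (fun _ v => (v - t)%:R) h.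
Proof.
move=> t0; elim: h => [|x h IH] /=; first by rewrite /occ_sum big_nil.
rewrite natrD IH occ_sum_cons ?sub0n// mem_level//; congr (_ + _).
case: leqP => tc; first by rewrite subSn// -natr1 addrAC subrr add0r.
have /eqP -> : (count_mem x h - t == 0)%N by rewrite subn_eq0 ltnW.
have /eqP -> : ((count_mem x h).+1 - t == 0)%N by rewrite subn_eq0.
by rewrite subrr.
Qed.

Lemma level_double_visits t h : (0 < t)%N ->
  (t * size (level (t * 2) h) <= visits (level t) h)%N.
Proof.
move=> t0; rewrite -(ler_nat R) natrM size_level visits_level// mulr_sumr.
by apply: ler_sum => z _; rewrite -natrM ler_nat; case: leqP => h1; rewrite ?muln1 ?muln0; lia.
Qed.

End Occupation.

(** * Exponential tails for visits to growing sets *)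

Section PotentialTails.
Context {R : realType} {V : zmodType} (N : seq V) (rho CG : R).
Hypothesis N_gt0 : (0 < size N)%N.
Hypothesis rho_ge0 : 0 <= rho.
Hypothesis CG_ge1 : 1 <= CG.
Hypothesis green_le : forall m x (s : seq V), uniq s ->
  \sum_(z <- s) green N m (x - z) <= CG * (size s)%:R `^ rho.

Let CG_gt0 : 0 < CG. Proof. exact: lt_le_trans CG_ge1. Qed.

Lemma green_le_cst m x : green N m x <= CG.
Proof.
have := green_le m x [:: 0] isT; rewrite big_seq1 subr0 /=.
by rewrite powR1 mulr1.
Qed.

(** Origin of the rate [(2 CG K^rho)^-1] below: it is the largest one for which the potential bound
    yields the smallness condition of [weighted_visits]. *)
Lemma small_potential (K : R) (s : seq V) m y : 0 < K -> uniq s -> (size s)%:R <= K ->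
  2 * (2 * CG * K `^ rho)^-1 * \sum_(z <- s) green N m (y - z) <= 1.
Proof.
move=> K0 us sK; have KR := powR_gt0 rho K0.
have -> : 2 * (2 * CG * K `^ rho)^-1 = (CG * K `^ rho)^-1 by field; rewrite !gt_eqF.
rewrite mulrC ler_pdivrMr ?mulr_gt0// mul1r.
apply: le_trans (green_le _ _ _ us) _; apply: ler_wpM2l; first exact: ltW.
by apply: ge0_ler_powR => //; rewrite nnegrE// ltW.
Qed.

(** A site entering the level adds at most [CG] to the potential, so the weight discounts [2 CG]
    visits for each member. The weight is 0 once the level has more than [K] members; levels only
    grow, so this acts as killing and loses nothing on the event. *)
Lemma level_step t (K L : R) n x : (0 < t)%N -> 0 < K ->
  walk_mean N n (fun _ h => (((size (level t h))%:R <= K) &&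
                             (L < (size (level (t * 2) h))%:R))%:R) x [::] <=
  2 * expR (- ((2 * CG * K `^ rho)^-1 * (t%:R * L - 2 * CG * K))).
Proof.
move=> t0 K0; set lam := (2 * CG * K `^ rho)^-1.
have lam0 : 0 < lam by rewrite invr_gt0 !mulr_gt0// powR_gt0.
pose sz (h : seq V) : R := (size (level t h))%:R.
pose W (h : seq V) : R := if sz h <= K then expR (lam * ((visits (level t) h)%:R - 2 * CG * sz
  h)) else 0.
have W0 h : 0 <= W h by rewrite /W; case: ifP => // _; exact: expR_ge0.
have Wgt h : 0 < W h -> sz h <= K by rewrite /W; case: ifP => //; rewrite ltxx.
have szS y h : sz (y :: h) = sz h + (t == (count_mem y h).+1)%:R.
  by rewrite /sz size_level_cons// natrD.
have Wn : W [::] <= 1.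
  rewrite /W; case: ifP => // _; rewrite /sz /level /= mulr0n mulr0 subr0 mulr0.
  by rewrite expR0.
pose b y h : R := CG * (sz (y :: h) - sz h).
have bE y h : b y h = CG * (t == (count_mem y h).+1)%:R by rewrite /b szS addrAC subrr add0r.
have key : walk_mean N n (fun _ h => W h) x [::] <= 2 * W [::].
  apply: (weighted_visits N N_gt0 W (level t) b lam) => //.
  - exact: ltW.
  - by move=> h; exact: level_uniq.
  - by move=> y h; rewrite bE mulr_ge0// ltW.
  - by move=> m y h /Wgt szK; apply: small_potential => //; exact: level_uniq.
  - move=> y h /Wgt szK; rewrite /W ifT ?expR_gt0//.
    by apply: le_trans szK; rewrite szS lerDl.
  - move=> y h /Wgt szK; have szK' : sz h <= K by apply: le_trans szK; rewrite szS lerDl.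
    rewrite /W !ifT// -!expRD ler_expR /= natrD /b.
    by rewrite le_eqVlt; apply/orP; left; apply/eqP; ring.
  - move=> m y z h _; rewrite sum_level_cons// lerD2l bE mulrC.
    by apply: ler_wpM2r => //; exact: green_le_cst.
set s := t%:R * L - 2 * CG * K.
apply: le_trans (walk_mean_markov N _ (fun _ h => (sz h <= K) && (L < (size (level (t * 2) h))%:R))
  (fun _ h => W h) (expR (lam * s)) _ _ _ _ _) _ => //.
- exact: expR_gt0.
- move=> y h _ /andP[szK Lh]; rewrite /W szK ler_expR ler_pM2l// /s.
  apply: lerB.
    apply: (@le_trans _ _ (t * size (level (t * 2) h))%:R); last first.
      by rewrite ler_nat level_double_visits.
    by rewrite natrM ler_wpM2l// ltW.
  by rewrite ler_wpM2l// mulr_ge0// ltW.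
- rewrite expRN mulrC ler_pdivrMr ?expR_gt0// -mulrA mulVf ?gt_eqF ?expR_gt0// mulr1.
  by apply: le_trans key _; rewrite ler_piMr.
Qed.

(** Histories start with the latest site, so the entries dropped are those of the current unfinished
    block. *)
Definition earlier_blocks (l : nat) (h : seq V) : seq V := undup (drop (size h %% l) h).

Lemma sum_undup_cat (g : V -> R) s1 s2 : (forall z, 0 <= g z) ->
  \sum_(z <- undup (s1 ++ s2)) g z <= \sum_(z <- undup s1) g z + \sum_(z <- undup s2) g z.
Proof.
move=> g0; rewrite undup_cat big_cat /= big_filter lerD2r big_mkcond /=.
by apply: ler_sum => z _; case: ifP.
Qed.

(** The set grows only when a block ends, by at most [l] sites together. Their joint potential is at
    most [CG l^rho], instead of [CG l] when sites are charged one by one; for [rho < 1] the discount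
    per unit of time thus becomes small for long blocks. *)
Lemma cross_block_visits (l n : nat) (s : R) x : (0 < l)%N -> (0 < n)%N ->
  walk_mean N n (fun _ h =>
    (2 * CG * l%:R `^ rho * (n %/ l)%:R + s <= (visits (earlier_blocks l) h)%:R)%R%:R) x [::] <=
  2 * expR (- ((2 * CG * n%:R `^ rho)^-1 * s)).
Proof.
move=> l0 n0; set lam := (2 * CG * n%:R `^ rho)^-1.
have nR : 0 < n%:R :> R by rewrite ltr0n.
have lam0 : 0 < lam by rewrite invr_gt0 !mulr_gt0// powR_gt0.
set L := earlier_blocks l; set c := 2 * CG * l%:R `^ rho.
have c0 : 0 <= c by rewrite /c !mulr_ge0 ?powR_ge0// ltW.
pose W (h : seq V) : R := if (size h <= n)%N then expR (lam * ((visits L h)%:R - c * (size h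
  %/ l)%:R)) else 0.
have W0 h : 0 <= W h by rewrite /W; case: ifP => // _; exact: expR_ge0.
have Wgt h : 0 < W h -> (size h <= n)%N by rewrite /W; case: ifP => //; rewrite ltxx.
have Wn : W [::] <= 1 by rewrite /W /= div0n mulr0 subr0 mulr0 expR0.
pose b (y : V) (h : seq V) : R := CG * l%:R `^ rho * (l %| (size h).+1)%N%:R.
have key : walk_mean N n (fun _ h => W h) x [::] <= 2 * W [::].
  apply: (weighted_visits N N_gt0 W L b lam) => //.
  - exact: ltW.
  - by move=> h; exact: undup_uniq.
  - by move=> y h; rewrite /b !mulr_ge0 ?powR_ge0// ltW.
  - move=> m y h /Wgt hn; apply: small_potential => //; first exact: undup_uniq.
    rewrite ler_nat; apply: leq_trans (size_undup _) _.
    by rewrite size_drop; apply: leq_trans hn; rewrite leq_subr.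
  - by move=> y h /Wgt /ltnW hn; rewrite /W ifT ?expR_gt0.
  - move=> y h /Wgt hn; have hn' := ltnW hn.
    rewrite /W !ifT// -!expRD ler_expR /= natrD divnS// natrD /b /c.
    by rewrite le_eqVlt; apply/orP; left; apply/eqP; ring.
  - move=> m y z h _; rewrite /L /earlier_blocks /b /= modnS.
    case: ifP => _; last by rewrite /= mulr0 addr0.
    rewrite drop0 [nat_of_bool true]/= mulr1; have -> : z :: h = (z :: take (size h %% l) h)
      ++ drop (size h %% l) h.
      by rewrite cat_cons cat_take_drop.
    apply: le_trans (sum_undup_cat _ _ _ _) _ => [v|]; first exact: green_ge0.
    rewrite addrC lerD2l; apply: le_trans (green_le _ _ _ (undup_uniq _)) _.
    apply: ler_wpM2l; first exact: ltW.
    apply: ge0_ler_powR; rewrite ?nnegrE// ler_nat.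
    apply: leq_trans (size_undup _) _ => /=; rewrite size_take.
    by have := ltn_pmod (size h) l0; case: ifP => //; lia.
apply: le_trans (walk_mean_markov N _ (fun _ h => c * (n %/ l)%:R + s <= (visits L h)%:R)
  (fun _ h => W h) (expR (lam * s)) _ _ _ _ _) _ => //.
- exact: expR_gt0.
- move=> y h /=; rewrite addn0 => hn Lh; rewrite /W hn leqnn ler_expR ler_pM2l//.
  lra.
- rewrite expRN mulrC ler_pdivrMr ?expR_gt0// -mulrA mulVf ?gt_eqF ?expR_gt0// mulr1.
  by apply: le_trans key _; rewrite ler_piMr.
Qed.

(** The weight of [weighted_visits] for one-point sets, summed over the visited sites: a site
    already seen gains nothing on average, and a step to a new site costs at most [2 expR lam]. *)
Lemma mean_exp_occupation n x :
  walk_mean N n (fun _ h => occ_sum (fun _ v => if v is 0%N then 0 else expR ((2 * CG)^-1 *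
    v%:R)) h)
    x [::] <= 2 * expR (2 * CG)^-1 * n%:R.
Proof.
set lam := (2 * CG)^-1; have lam0 : 0 < lam by rewrite invr_gt0 mulr_gt0.
have lamG m z : 2 * lam * green N m z <= 1.
  have := ler_wpM2l (ltW lam0) (green_le_cst m z).
  have : lam * CG = 2^-1 by rewrite /lam; field; rewrite gt_eqF.
  lra.
have lamG0 m z : 0 <= 2 * lam * green N m z by rewrite !mulr_ge0 ?green_ge0// ltW.
pose f m (y z : V) (v : nat) : R := if v is 0%N then 0 else expR (lam * v%:R) * (1 + 2 * lam *
  green N m (y - z)).
pose M m (y : V) (h : seq V) : R := occ_sum (f m y) h + 2 * expR lam * m%:R.
have -> : walk_mean N n (fun _ h => occ_sum (fun _ v => if v is 0%N then 0 else expR (lam *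
  v%:R)) h)
    x [::] = walk_mean N n (M 0%N) x [::].
  apply: eq_walk_mean => y h _; rewrite /M mulr0 addr0; apply: eq_bigr => z _.
  by rewrite /f; case: (count_mem z h) => // v; rewrite /green big_ord0 mulr0 addr0 mulr1.
have -> : 2 * expR lam * n%:R = M n x [::] by rewrite /M /occ_sum big_nil add0r.
apply: walk_mean_supermartingale => m y h.
rewrite /M avgD avg_cst// -[m.+1%:R]natr1 mulrDr mulr1 [leRHS]addrA [leRHS]addrAC lerD2r.
have step z (v : nat) : (0 < v)%N ->
    avg N (fun e => f m (y + e) z (v + (y == z))%N) <= f m.+1 y z v.
  move=> v0; rewrite /f; case: v v0 => // v _; rewrite addSn avgZ avgD avg_cst// avgZ.
  under eq_avg do rewrite addrAC.
  pose g : R := avg N (fun e => green N m (y - z + e)); pose g' : R := green N m.+1 (y - z).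
  have gE : g = g' - (y == z)%:R.
    by rewrite /g' greenS subr_eq0 addrAC subrr add0r.
  rewrite -/g -/g'.
  have g0 : 0 <= 2 * lam * g.
    by apply: mulr_ge0; [rewrite mulr_ge0 ?ltW|apply: avg_ge0 => e; exact: green_ge0].
  have := lamG m.+1 (y - z); rewrite -/g' => g'1.
  rewrite -addSn natrD [lam * (_ + _)]mulrDr expRD -mulrA ler_wpM2l ?expR_ge0// gE.
  set w : R := (y == z)%:R; have w1 : 0 <= w <= 1 by rewrite ler0n lern1 leq_b1.
  have lw0 : 0 <= lam * w by rewrite mulr_ge0 ?(ltW lam0)//; lra.
  rewrite -ler_pdivlMl ?expR_gt0// -expRN.
  apply: (@le_trans _ _ ((1 + - (lam * w)) * (1 + 2 * lam * g'))); last first.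
    rewrite ler_wpM2r ?expR_ge1Dx// addr_ge0//.
    by rewrite !mulr_ge0 ?green_ge0// ltW.
  have := mulr_ge0 lw0 (_ : 0 <= 1 - 2 * lam * g'); rewrite subr_ge0 => /(_ g'1); lra.
rewrite /occ_sum avg_sum /=.
have new z : z \notin h -> avg N (fun e => f m (y + e) z (count_mem z (z :: h))) <= 2 * expR lam.
  move=> zh; rewrite /= eqxx (count_memPn zh) addn0 /f mulr1 avgZ mulrC ler_wpM2r ?expR_ge0//.
  rewrite -[leRHS](avg_cst N N_gt0); apply: avg_le => e.
  by have := lamG m (y + e - z); lra.
have old s : {subset s <= h} ->
    \sum_(z <- s) avg N (fun e => f m (y + e) z (count_mem z (y :: h))) <=
    \sum_(z <- s) f m.+1 y z (count_mem z h).
  move=> sh; rewrite big_seq [leRHS]big_seq; apply: ler_sum => z zs.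
  rewrite /= addnC; apply: step; by rewrite -has_count has_pred1 sh.
case: ifP => yh.
  rewrite addrC -[leLHS]add0r lerD ?mulr_ge0 ?expR_ge0//.
  by apply: old => z; rewrite mem_undup.
rewrite big_cons addrC lerD ?new ?yh//.
by apply: old => z; rewrite mem_undup.
Qed.

End PotentialTails.

(** * Time blocks *)
Section Blocks.
Context {R : realType} {V : zmodType} (q : R).
Hypothesis q_ge1 : 1 <= q.

Definition powq (v : nat) : R := v%:R `^ q.

Let q_gt0 : 0 < q. Proof. exact: lt_le_trans q_ge1. Qed.

Lemma powq0 : powq 0 = 0.
Proof. by rewrite /powq powR0// gt_eqF. Qed.

Lemma powq_ge0 v : 0 <= powq v.
Proof. exact: powR_ge0. Qed.

Lemma powq_le a b : (a <= b)%N -> powq a <= powq b.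
Proof.
by move=> ab; apply: ge0_ler_powR; rewrite ?nnegrE ?ler_nat// ltW.
Qed.

Lemma powq_convex a b : (a <= b)%N -> powq a.+1 - powq a <= powq b.+1 - powq b.
Proof.
move=> ab; rewrite -(subnKC ab); elim: (b - a)%N => [|j IH]; first by rewrite addn0.
apply: le_trans IH _; rewrite addnS; move: (a + j)%N => v.
have i0 : (0 : R) <= 2^-1 by lra.
have i1 : (2^-1 : R) <= 1 by lra.
have := convex_powR q_ge1 (Itv01 i0 i1) (x := v%:R) (y := v.+2%:R).
rewrite !inE /= !in_itv /= !andbT !ler0n => /(_ isT isT).
rewrite convRE [X in X `^ _ <= _]convRE /= /unstable.onem.
have -> : 2^-1 * v%:R + (1 - 2^-1) * v.+2%:R = v.+1%:R :> R.
  by rewrite -[v.+2%:R]natr1 -[v.+1%:R]natr1; field.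
rewrite -!/(powq _); lra.
Qed.

Definition norm_pow (h : seq V) : R := occ_sum (fun _ v => powq v) h.

Definition capped_pow (A : nat) (h : seq V) : R := occ_sum (fun _ v => powq (minn v A)) h.

(* The last block, of [size h %% l] sites, may be incomplete. *)
Fixpoint block_sum (l : nat) (h : seq V) : R :=
  if h is x :: h' then
    let c := count_mem x (take (size h' %% l) h') in
    block_sum l h' + (powq c.+1 - powq c)
  else 0.

Lemma norm_pow_cons x h :
  norm_pow (x :: h) = norm_pow h + (powq (count_mem x h).+1 - powq (count_mem x h)).
Proof. by rewrite /norm_pow occ_sum_cons// => _; exact: powq0. Qed.

Lemma norm_pow_ge0 h : 0 <= norm_pow h.
Proof. by apply: occ_sum_ge0 => _; exact: powq_ge0. Qed.

Lemma norm_pow_le h : norm_pow h <= (size h)%:R * powq (size h).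
Proof.
rewrite /norm_pow /occ_sum; apply: (@le_trans _ _ (\sum_(z <- undup h) powq (size h))).
  by apply: ler_sum => z _; apply: powq_le; exact: count_size.
rewrite big_const_seq count_predT iter_addr_0 -[_ *+ size (undup h)]mulr_natl.
by rewrite ler_wpM2r ?powq_ge0// ler_nat size_undup.
Qed.

Lemma block_sum_cons l x h : block_sum l h <= block_sum l (x :: h).
Proof. by rewrite /= lerDl subr_ge0; exact: powq_le. Qed.

Lemma block_sum_cat l g h : block_sum l h <= block_sum l (g ++ h).
Proof. by elim: g => // x g IH; apply: le_trans IH _; exact: block_sum_cons. Qed.

Lemma count_take_le x n (h : seq V) : (count_mem x (take n h) <= count_mem x h)%N.
Proof. by rewrite -[in leqRHS](cat_take_drop n h) count_cat leq_addr. Qed.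

Lemma block_sum_le_norm l h : block_sum l h <= norm_pow h.
Proof.
elim: h => [|x h IH]; first by rewrite norm_pow_ge0.
by rewrite norm_pow_cons /= lerD// powq_convex// count_take_le.
Qed.

Lemma block_sum_next l g h : (l %| size h)%N -> (size g <= l)%N ->
  block_sum l (g ++ h) = block_sum l h + norm_pow g.
Proof.
move=> lh; elim: g => [|x g IH] gl; first by rewrite /norm_pow /occ_sum big_nil addr0.
rewrite norm_pow_cons addrA -IH 1?ltnW//= size_cat.
by rewrite -modnDmr (eqP lh) addn0 modn_small// take_size_cat.
Qed.

(* Only at sites revisited in a later block can the capped powers exceed the
   sum over the blocks. *)
Lemma capped_pow_le l A h :
  capped_pow A h <= block_sum l h + powq A * (visits (earlier_blocks l) h)%:R.
Proof.
elim: h => [|x h IH]; first by rewrite /capped_pow /occ_sum big_nil /= mulr0 addr0.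
rewrite {1}/capped_pow occ_sum_cons; last by move=> z; rewrite min0n powq0.
rewrite -/(capped_pow A h) /= natrD mulrDr addrACA lerD//.
set c := count_mem x h; set c' := count_mem x _.
have c'0 : 0 <= powq c'.+1 - powq c' by rewrite subr_ge0; exact: powq_le.
case: (boolP (x \in earlier_blocks l h)) => xe /=.
  rewrite mulr1 -[leLHS]add0r lerD// lerBlDr -[leLHS]addr0 lerD ?powq_ge0//.
  by apply: powq_le; exact: geq_minr.
rewrite mulr0 addr0.
have cc' : c = c'.
  rewrite /c -[in LHS](cat_take_drop (size h %% l) h) count_cat -/c'.
  move: xe; rewrite /earlier_blocks mem_undup => /count_memPn ->.
  by rewrite addn0.
rewrite cc'; case: (leqP c'.+1 A) => cA; first by rewrite (minn_idPl (ltnW cA)).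
by rewrite (minn_idPr (_ : A <= c')%N)// subrr.
Qed.

Lemma norm_pow_shift x g : norm_pow [seq z + x | z <- g] = norm_pow g.
Proof.
have inj : injective (fun z : V => z + x) by exact: addIr.
elim: g => //= y g IH; rewrite !norm_pow_cons IH; congr (_ + (powq _.+1 - powq _)).
  by rewrite count_map; apply: eq_count => z /=; rewrite (inj_eq inj).
by rewrite count_map; apply: eq_count => z /=; rewrite (inj_eq inj).
Qed.

Variable N : seq V.
Hypothesis N_gt0 : (0 < size N)%N.

Lemma walk_mean_next_block l (F : R -> R) x h : (l %| size h)%N ->
  walk_mean N l (fun _ g => F (block_sum l g)) x h =
  walk_mean N l (fun _ g => F (block_sum l h + norm_pow g)) 0 [::].
Proof.
move=> lh; have := walk_mean_shift N l (fun _ g => F (block_sum l g)) x h 0 [::].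
rewrite add0r /= => ->; apply: eq_walk_mean => y g; rewrite /= addn0 => gl.
by rewrite block_sum_next ?norm_pow_shift// size_map gl.
Qed.

Lemma walk_mean_block_exp l k (lam : R) x h : (l %| size h)%N ->
  walk_mean N (k * l) (fun _ g => expR (lam * block_sum l g)) x h =
  expR (lam * block_sum l h) *
    walk_mean N l (fun _ g => expR (lam * norm_pow g)) 0 [::] ^+ k.
Proof.
elim: k x h => [|k IH] x h lh; first by rewrite mul0n expr0 mulr1.
rewrite mulSn walk_mean_comp.
rewrite (eq_walk_mean N l _ (fun _ g => walk_mean N l (fun _ g => expR (lam * norm_pow g)) 0
  [::] ^+ k * expR (lam * block_sum l g))).
  rewrite walk_meanZ (walk_mean_next_block l (fun u => expR (lam * u)))//.
  rewrite exprSr mulrCA; congr (_ * _); rewrite -walk_meanZ.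
  by apply: eq_walk_mean => y g _; rewrite mulrDr expRD.
move=> y g gl; rewrite IH; last by rewrite gl dvdn_addr.
exact: mulrC.
Qed.

Lemma walk_mean_block_sum l k x h : (l %| size h)%N ->
  walk_mean N (k * l) (fun _ g => block_sum l g) x h =
  block_sum l h + k%:R * walk_mean N l (fun _ g => norm_pow g) 0 [::].
Proof.
elim: k x h => [|k IH] x h lh; first by rewrite mul0n mul0r addr0.
rewrite mulSn walk_mean_comp.
rewrite (eq_walk_mean N l _ (fun _ g => block_sum l g + k%:R * walk_mean N l (fun _ g =>
  norm_pow g) 0 [::])).
  rewrite walk_meanD walk_mean_cst// (walk_mean_next_block l id)// walk_meanD.
  by rewrite walk_mean_cst// -natr1 mulrDl mul1r addrAC addrA.
move=> y g gl; rewrite IH; last by rewrite gl dvdn_addr.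
by [].
Qed.

Lemma expR_le_quadratic (y : R) : y <= 2^-1 -> expR y <= 1 + y + 2 * y ^+ 2.
Proof.
move=> y1; have y0 : 0 < 1 - y by lra.
have := expR_ge1Dx (- y); rewrite expRN => h.
have e0 := expR_gt0 y.
have : expR y <= (1 - y)^-1.
  by rewrite -[leLHS]invrK lef_pV2 ?posrE ?invr_gt0.
move=> /le_trans; apply; rewrite -[leLHS]mul1r ler_pdivrMr//.
have : 0 <= y ^+ 2 * (1 - 2 * y) by rewrite mulr_ge0 ?sqr_ge0//; lra.
have -> : (1 + y + 2 * y ^+ 2) * (1 - y) = 1 + y ^+ 2 * (1 - 2 * y) by ring.
lra.
Qed.

(** Second-order expansion of the exponential around the mean [mu], where the linear term averages
    to 0. *)
Lemma walk_mean_exp_norm_pow l (lam B : R) : 0 <= lam -> lam * B <= 2^-1 ->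
  l%:R * powq l <= B ->
  walk_mean N l (fun _ g => expR (lam * norm_pow g)) 0 [::] <=
  expR (lam * walk_mean N l (fun _ g => norm_pow g) 0 [::] + 2 * (lam * B) ^+ 2).
Proof.
move=> lam0 lamB lB; set mu := walk_mean N l (fun _ g => norm_pow g) 0 [::].
have mu0 : 0 <= mu by apply: walk_mean_ge0 => // y g; exact: norm_pow_ge0.
have nB g : size g = (l + size ([::] : seq V))%N -> norm_pow g <= B.
  by rewrite addn0 => gl; apply: le_trans (norm_pow_le _) _; rewrite gl.
have muB : mu <= B.
  rewrite -(walk_mean_cst N N_gt0 l B 0 [::]); apply: walk_mean_le => // y g; exact: nB.
have B0 : 0 <= B by apply: le_trans muB.
apply: (@le_trans _ _ (walk_mean N l (fun _ g => expR (lam * mu) *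
    ((1 + 2 * (lam * B) ^+ 2 - lam * mu) + lam * norm_pow g)) 0 [::])).
  apply: walk_mean_le => // y g /nB gB; have g0 := norm_pow_ge0 g.
  have -> : lam * norm_pow g = lam * mu + lam * (norm_pow g - mu) by ring.
  rewrite expRD ler_wpM2l ?expR_ge0//.
  have u1 : lam * (norm_pow g - mu) <= 2^-1.
    by apply: le_trans lamB; rewrite ler_wpM2l//; lra.
  apply: le_trans (expR_le_quadratic _ u1) _.
  have : (lam * (norm_pow g - mu)) ^+ 2 <= (lam * B) ^+ 2.
    rewrite -[leLHS]real_normK ?num_real// lerXn2r ?nnegrE ?mulr_ge0//.
    by rewrite normrM ger0_norm// ler_wpM2l// ler_norml; apply/andP; split; lra.
  lra.
rewrite walk_meanZ walk_meanD walk_mean_cst// walk_meanZ -/mu expRD ler_wpM2l ?expR_ge0//.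
by rewrite subrK expR_ge1Dx.
Qed.

(** Chernoff bound for the complete blocks. Centering at the mean of the whole norm is legitimate
    because superadditivity gives [k mu <= E]; the unfinished last block adds at most [lam B <= 1/4]
    to the exponent, whence the factor 2. *)
Lemma block_sum_tail l n (delta B : R) : (0 < l)%N -> 0 < delta -> delta <= B ->
  l%:R * powq l <= B ->
  walk_mean N n (fun _ h =>
    (walk_mean N n (fun _ h => norm_pow h) 0 [::] + delta * n%:R <= block_sum l h)%R%:R) 0 [::]
  <= 2 * expR (- (delta ^+ 2 / (8 * B ^+ 2) * n%:R)) :> R.
Proof.
move=> l0 delta0 dB lB; have B0 : 0 < B by exact: lt_le_trans dB.
set mu := walk_mean N l (fun _ g => norm_pow g) 0 [::].
set E := walk_mean N n (fun _ h => norm_pow h) 0 [::].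
pose k := (n %/ l)%N; pose r := (n %% l)%N.
have nkr : n = (k * l + r)%N by exact: divn_eq.
have kn : k%:R <= n%:R :> R by rewrite ler_nat leq_div.
have kE : k%:R * mu <= E.
  rewrite -[leLHS]add0r -[X in X + _]/(block_sum l [::]) -(walk_mean_block_sum l k 0 [::])//.
  rewrite /E [in leRHS]nkr walk_mean_comp; apply: walk_mean_le => // y h _.
  have := walk_mean_shift N r (fun _ g => norm_pow g) y h 0 [::]; rewrite add0r /= => ->.
  rewrite -[leLHS](walk_mean_cst N N_gt0 r (block_sum l h) 0 [::]).
  apply: walk_mean_le => // y' g _; apply: le_trans (block_sum_le_norm l _).
  exact: block_sum_cat.
(* The minimiser of [2 (lam B)^2 - lam delta], with minimum [- delta^2 / (8 B^2)]. *)
pose lam := delta / (4 * B ^+ 2).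
have lam0 : 0 < lam by rewrite divr_gt0 ?mulr_gt0// exprn_gt0.
have lamBE : lam * B = delta / (4 * B) by rewrite /lam; field; rewrite gt_eqF.
have lamB : lam * B <= 4^-1.
  by rewrite lamBE invfM mulrCA -[leRHS]mulr1 ler_wpM2l// ler_pdivrMr// mul1r.
have expn : walk_mean N n (fun _ h => expR (lam * block_sum l h)) 0 [::] <=
    expR (lam * B + k%:R * (lam * mu + 2 * (lam * B) ^+ 2)).
  rewrite nkr walk_mean_comp.
  apply: (@le_trans _ _ (walk_mean N (k * l) (fun _ h => expR (lam * B) * expR (lam *
    block_sum l h)) 0 [::])).
    apply: walk_mean_le => // y h; rewrite addn0 => hs.
    have := walk_mean_shift N r (fun _ g => expR (lam * block_sum l g)) y h 0 [::].
    rewrite add0r /= => ->.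
    rewrite -[leRHS](walk_mean_cst N N_gt0 r _ 0 [::]).
    apply: walk_mean_le => // y' g; rewrite addn0 => gr.
    have rl : (r <= l)%N by exact/ltnW/ltn_pmod.
    rewrite block_sum_next; [|by rewrite hs dvdn_mull|by rewrite size_map gr].
    rewrite -expRD ler_expR mulrDr addrC lerD2r ler_pM2l//.
    apply: le_trans (norm_pow_le _) _; rewrite size_map gr; apply: le_trans lB.
    by apply: ler_pM => //; rewrite ?powq_ge0 ?ler_nat ?powq_le.
  rewrite walk_meanZ expRD ler_wpM2l ?expR_ge0// walk_mean_block_exp//.
  rewrite mulr0 expR0 mul1r expRM_natl; apply: lerXn2r; rewrite ?nnegrE ?expR_ge0//.
    by apply: walk_mean_ge0 => // *; exact: expR_ge0.
  by apply: walk_mean_exp_norm_pow => //; [exact: ltW|lra].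
apply: le_trans (walk_mean_markov N _ (fun _ h => E + delta * n%:R <= block_sum l h)
  (fun _ h => expR (lam * block_sum l h)) (expR (lam * (E + delta * n%:R))) _ _ _ _ _) _.
- exact: expR_gt0.
- by move=> *; exact: expR_ge0.
- by move=> y h _ h1; rewrite ler_expR ler_pM2l.
rewrite mulrC ler_pdivrMr ?expR_gt0//; apply: le_trans expn _.
have e2 : expR (4^-1) <= 2 :> R.
  by apply: le_trans (expR_le_quadratic _ _) _; lra.
apply: (@le_trans _ _ (expR (4^-1) * (expR (- (delta ^+ 2 / (8 * B ^+ 2) * n%:R)) *
    expR (lam * (E + delta * n%:R))))); last first.
  by rewrite mulrA ler_wpM2r ?expR_ge0// ler_wpM2r ?expR_ge0.
rewrite -!expRD ler_expR lerD// [lam * (_ + _)]mulrDr.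
have h1 := ler_wpM2l (ltW lam0) kE.
have h2 : 2 * (lam * B) ^+ 2 = delta ^+ 2 / (8 * B ^+ 2).
  by rewrite lamBE; field; rewrite gt_eqF.
have h3 : lam * (delta * n%:R) = 2 * (delta ^+ 2 / (8 * B ^+ 2)) * n%:R.
  by rewrite /lam; field; rewrite gt_eqF.
have h4 : k%:R * (delta ^+ 2 / (8 * B ^+ 2)) <= n%:R * (delta ^+ 2 / (8 * B ^+ 2)).
  by apply: ler_wpM2r => //; apply: divr_ge0; [exact: sqr_ge0|rewrite mulr_ge0 ?sqr_ge0].
rewrite h2 h3; lra.
Qed.

End Blocks.

(** * Sites visited a bounded number of times *)

Section LowOccupation.
Context {R : realType} {V : zmodType} (N : seq V) (rho CG q : R).
Hypothesis N_gt0 : (0 < size N)%N.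
Hypothesis rho_ge0 : 0 <= rho.
Hypothesis rho_lt1 : rho < 1.
Hypothesis CG_ge1 : 1 <= CG.
Hypothesis green_le : forall m x (s : seq V), uniq s ->
  \sum_(z <- s) green N m (x - z) <= CG * (size s)%:R `^ rho.
Hypothesis q_ge1 : 1 <= q.

Let CG_gt0 : 0 < CG. Proof. exact: lt_le_trans CG_ge1. Qed.
Let q_gt0 : 0 < q. Proof. exact: lt_le_trans q_ge1. Qed.

Lemma powq_le_exp (lam : R) v : 0 < lam ->
  powq q v <= (q / lam) `^ q * expR (lam * v%:R).
Proof.
move=> lam0; rewrite /powq.
have h : v%:R <= q / lam * expR (lam * v%:R / q).
  rewrite -ler_pdivrMl ?divr_gt0// invf_div.
  apply: le_trans (expR_ge1Dx _); rewrite mulrAC -[leLHS]add0r.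
  by rewrite lerD.
apply: (@le_trans _ _ ((q / lam * expR (lam * v%:R / q)) `^ q)).
  apply: ge0_ler_powR => //; rewrite ?nnegrE//; first exact: ltW.
  by apply: mulr_ge0; [apply: divr_ge0; exact: ltW|exact: expR_ge0].
rewrite powRM; [|by apply: divr_ge0; exact: ltW|exact: expR_ge0].
by rewrite -expRM divfK ?gt_eqF//.
Qed.

Lemma norm_pow_mean_le : exists2 C : R, 0 < C & forall n x,
  walk_mean N n (fun _ h => norm_pow q h) x [::] <= C * n%:R.
Proof.
set lam := (2 * CG)^-1; have lam0 : 0 < lam by rewrite invr_gt0 mulr_gt0.
pose K := (q / lam) `^ q; have K0 : 0 < K by rewrite powR_gt0 ?divr_gt0.
exists (K * (2 * expR lam)); first by rewrite !mulr_gt0 ?expR_gt0.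
move=> n x; rewrite -mulrA.
apply: le_trans _ (ler_wpM2l (ltW K0) (mean_exp_occupation _ _ _ N_gt0 CG_ge1 green_le n x)).
rewrite -walk_meanZ; apply: walk_mean_le => // y h _.
rewrite /norm_pow /occ_sum mulr_sumr; apply: ler_sum => z _.
by case: (count_mem z h) => [|v]; [rewrite powq0// mulr0|exact: powq_le_exp].
Qed.

Lemma low_occupation_tail (A : nat) : exists2 c : R, 0 < c & forall n, (0 < n)%N ->
  walk_mean N n (fun _ h =>
    (walk_mean N n (fun _ h => norm_pow q h) 0 [::] + n%:R / 2 <= capped_pow q A h)%R%:R) 0 [::]
  <= 4 * expR (- (c * n%:R `^ (1 - rho))) :> R.
Proof.
pose a := powq q A; have a0 : 0 <= a by exact: powq_ge0.
(* Of the excess [n/2], the blocks may use [n/4]. The capped revisits get [n/8] for their discount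
   [2 CG l^rho (n / l)], which requires [K <= l^(1 - rho)], and [n/8] for their fluctuation [s]; the
   16 and the 8 in [s] come from this. *)
pose K := 16 * CG * (a + 1).
have K0 : 0 < K by rewrite !mulr_gt0//; lra.
have r0 : 0 < 1 - rho by rewrite subr_gt0.
pose l := (Num.truncn (K `^ (1 - rho)^-1)).+1.
have lR : 0 < l%:R :> R by rewrite ltr0n.
have Kl : K <= l%:R `^ (1 - rho).
  have -> : K = (K `^ (1 - rho)^-1) `^ (1 - rho).
    by rewrite -powRrM mulVf ?gt_eqF// powRr1// ltW.
  apply: ge0_ler_powR; rewrite ?nnegrE ?powR_ge0 ?(ltW r0)//.
  by apply/ltW; exact: truncnS_gt.
pose B := Num.max 1 (l%:R * powq q l).
have B1 : 1 <= B by rewrite le_max lexx.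
pose c1 : R := 4^-1 ^+ 2 / (8 * B ^+ 2).
have c10 : 0 < c1 by rewrite divr_gt0 ?exprn_gt0 ?mulr_gt0 ?exprn_gt0//; lra.
(* [K^-1 n^(1 - rho)] is the exponent of the revisits; the blocks have the better exponent
   [c1 n]. *)
exists (Num.min c1 K^-1); first by rewrite lt_min c10 invr_gt0.
move=> n n0; have nR : 1 <= n%:R :> R by rewrite ler1n.
have nR0 : 0 < n%:R :> R by exact: lt_le_trans nR.
set E := walk_mean N n (fun _ h => norm_pow q h) 0 [::].
pose s : R := n%:R / (8 * (a + 1)).
have a8 : 0 < 8 * (a + 1) by rewrite mulr_gt0//; lra.
apply: (@le_trans _ _ (walk_mean N n (fun _ h => (E + 4^-1 * n%:R <= block_sum q l h)%R%:R +
    (2 * CG * l%:R `^ rho * (n %/ l)%:R + s <= (visits (earlier_blocks l) h)%:R)%R%:R) 0 [::])).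
  apply: walk_mean_le => // y h _.
  have le1 (b : bool) : b%:R <= 1 :> R by rewrite lern1 leq_b1.
  case: (boolP (E + 4^-1 * n%:R <= _)) => hb.
    by apply: le_trans (le1 _) _; rewrite lerDl.
  rewrite add0r; case: (boolP (_ + s <= _)) => hv; first exact: le1.
  rewrite -!ltNge in hb hv.
  suff -> : (E + n%:R / 2 <= capped_pow q A h) = false by [].
  apply/negbTE; rewrite -ltNge; apply: le_lt_trans (capped_pow_le q q_ge1 l A h) _.
  rewrite -/a.
  have as_le : a * s <= n%:R / 8.
    rewrite /s mulrA ler_pdivrMr// mulrC -mulrA ler_wpM2l// [_^-1 * _]mulrA mulVf//; lra.
  have al_le : a * (2 * CG * l%:R `^ rho * (n %/ l)%:R) <= n%:R / 8.
    have lrho : K * l%:R `^ rho <= l%:R.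
      rewrite -[leRHS](powRr1 (ltW lR)) -[X in _ <= _ `^ X](subrK rho) [leRHS]powRD; last first.
        by rewrite (gt_eqF lR) implybT.
      by rewrite ler_wpM2r ?powR_ge0.
    have h1 : K * l%:R `^ rho * (n %/ l)%:R <= n%:R.
      apply: le_trans (ler_wpM2r (ler0n _ _) lrho) _.
      by rewrite -natrM ler_nat mulnC leq_trunc_div.
    have h2 : 0 <= CG * l%:R `^ rho * (n %/ l)%:R by rewrite !mulr_ge0 ?powR_ge0// ltW.
    set u := CG * _ * _ in h2.
    have e1 : K * l%:R `^ rho * (n %/ l)%:R = 16 * (a * u + u) by rewrite /K /u; ring.
    have e2 : a * (2 * CG * l%:R `^ rho * (n %/ l)%:R) = 2 * (a * u) by rewrite /u; ring.
    by rewrite e2; rewrite e1 in h1; lra.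
  have := ler_wpM2l a0 (ltW hv); rewrite mulrDr; lra.
rewrite walk_meanD.
have h1 : walk_mean N n (fun _ h => (E + 4^-1 * n%:R <= block_sum q l h)%R%:R) 0 [::] <=
    2 * expR (- (c1 * n%:R)).
  apply: block_sum_tail => //; first by lra.
  by rewrite le_max lexx orbT.
have h2 := cross_block_visits _ _ _ N_gt0 rho_ge0 CG_ge1 green_le l n s 0 isT n0.
have e1 : expR (- (c1 * n%:R)) <= expR (- (Num.min c1 K^-1 * n%:R `^ (1 - rho))).
  rewrite ler_expR lerN2; apply: ler_pM; rewrite ?powR_ge0//.
  - by rewrite le_min (ltW c10) invr_ge0 ltW.
  - by rewrite ge_min lexx.
  - by rewrite -[leRHS](powRr1 (ltW nR0)); apply: ler_powR; rewrite ?gerBl.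
have e2 : expR (- ((2 * CG * n%:R `^ rho)^-1 * s)) <= expR (- (Num.min c1 K^-1 * n%:R `^ (1 -
  rho))).
  have -> : (2 * CG * n%:R `^ rho)^-1 * s = K^-1 * n%:R `^ (1 - rho).
    rewrite powRB ?(gt_eqF nR0) ?implybT// powRr1 ?(ltW nR0)// /s /K.
    have := powR_gt0 rho nR0; move: (n%:R `^ rho) => p p0.
    by field; rewrite !gt_eqF//; lra.
  by rewrite ler_expR lerN2 ler_wpM2r ?powR_ge0// ge_min lexx orbT.
lra.
Qed.

End LowOccupation.

(** * The ladder of occupation levels *)
Section Ladder.
Context {R : realType} {V : zmodType} (N : seq V) (rho CG q eta : R).
Hypothesis N_gt0 : (0 < size N)%N.
Hypothesis rho_ge0 : 0 <= rho.
Hypothesis rho_lt1 : rho < 1.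
Hypothesis CG_ge1 : 1 <= CG.
Hypothesis green_le : forall m x (s : seq V), uniq s ->
  \sum_(z <- s) green N m (x - z) <= CG * (size s)%:R `^ rho.
Hypothesis q_ge1 : 1 <= q.
Hypothesis eta_gt0 : 0 < eta.
Hypothesis supercritical : 1 < (q - eta) * (1 - rho).

Let CG_gt0 : 0 < CG. Proof. exact: lt_le_trans CG_ge1. Qed.
Let q_gt0 : 0 < q. Proof. exact: lt_le_trans q_ge1. Qed.
Let rho1_gt0 : 0 < 1 - rho. Proof. by rewrite subr_gt0. Qed.
Let s1_gt0 : 0 < q - eta.
Proof. by rewrite -(pmulr_lgt0 _ rho1_gt0) (lt_trans _ supercritical). Qed.
Let s0_gt0 : 0 < q + eta. Proof. exact: addr_gt0. Qed.

Variables (t0 : nat) (c : R).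
Hypothesis t0_large : 4 * CG * 2 `^ (q + eta) <= t0%:R.
Hypothesis c_gt0 : 0 < c.

Definition rung (j : nat) : nat := (t0 * 2 ^ j)%N.

(* The first term makes the bound trivial at [j = 0]; the second one is what
   remains at the top rungs, where [rung j] is of order [tau]. *)
Definition rung_cap (n : nat) (tau : R) (j : nat) : R :=
  n%:R * (2 ^+ j) `^ (- (q + eta)) + c * (tau / (rung j)%:R) `^ (q - eta).

Let p_gt0 : 0 < 2 `^ (q + eta) :> R. Proof. exact: powR_gt0. Qed.

Lemma t0_gt0 : (0 < t0)%N.
Proof. by rewrite -(ltr0n R); apply: lt_le_trans t0_large; rewrite !mulr_gt0. Qed.

Lemma rung_gt0 j : (0 < rung j)%N.
Proof. by rewrite muln_gt0 t0_gt0 expn_gt0. Qed.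

Let rungR_gt0 j : 0 < (rung j)%:R :> R. Proof. by rewrite ltr0n rung_gt0. Qed.

Lemma rungS j : rung j.+1 = (rung j * 2)%N.
Proof. by rewrite /rung expnSr mulnA. Qed.

Lemma rungE j : (rung j)%:R = t0%:R * 2 ^+ j :> R.
Proof. by rewrite /rung natrM natrX. Qed.

Lemma rung_cap_half n tau j : 0 <= tau ->
  rung_cap n tau j <= 2 `^ (q + eta) * rung_cap n tau j.+1.
Proof.
move=> tau0; rewrite /rung_cap mulrDr; apply: lerD.
  have -> : (2 ^+ j.+1) `^ (- (q + eta)) = (2 `^ (q + eta))^-1 * (2 ^+ j) `^ (- (q + eta)).
    by rewrite exprS powRM ?exprn_ge0// powRN.
  by rewrite mulrCA mulVKf// gt_eqF.
rewrite mulrCA ler_pM2l//.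
have -> : (tau / (rung j.+1)%:R) `^ (q - eta) = (tau / (rung j)%:R) `^ (q - eta) * 2^-1 `^ (q
  - eta).
  by rewrite rungS natrM invfM mulrA powRM// divr_ge0.
rewrite mulrCA.
rewrite -[leLHS]mulr1 ler_wpM2l ?powR_ge0//.
have -> : (2^-1 : R) `^ (q - eta) = (2 `^ (q - eta))^-1.
  by rewrite -powR_inv1// -powRrM mulN1r powRN.
rewrite ler_pdivlMr ?powR_gt0// mul1r; apply: ler_powR; first by rewrite ler1n.
by have := eta_gt0; lra.
Qed.

(** At level [t] the exponent of a failure is of order [t K^(1 - rho)]. With
    [K >= c (tau / t)^(q - eta)] this is at least a constant times [tau (tau / t)^rung_exp], and
    supercriticality makes [rung_exp] positive, so the exponent is smallest at the top rung. *)
Definition rung_rate : R := c `^ (1 - rho) / (4 * CG * 2 `^ (q + eta)).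
Definition rung_exp : R := (q - eta) * (1 - rho) - 1.

Lemma rung_rate_gt0 : 0 < rung_rate.
Proof. by rewrite divr_gt0 ?powR_gt0// !mulr_gt0. Qed.

Lemma rung_exp_gt0 : 0 < rung_exp. Proof. by rewrite subr_gt0. Qed.

Lemma rung_fail n tau y j x : 0 < tau -> (rung j)%:R <= y ->
  walk_mean N n (fun _ h => (((size (level (rung j) h))%:R <= rung_cap n tau j) &&
     (rung_cap n tau j.+1 < (size (level (rung j.+1) h))%:R))%:R) x [::] <=
  2 * expR (- (rung_rate * (tau * (tau / y) `^ rung_exp))).
Proof.
move=> tau0 ty; set K := rung_cap n tau j; set L := rung_cap n tau j.+1.
have t0' := rungR_gt0 j; set t : R := (rung j)%:R in ty t0'.
have y0 : 0 < y by exact: lt_le_trans ty.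
have Kge : c * (tau / t) `^ (q - eta) <= K.
  by rewrite /K /rung_cap lerDr mulr_ge0 ?powR_ge0.
have K0 : 0 < K by apply: lt_le_trans Kge; rewrite mulr_gt0 ?powR_gt0 ?divr_gt0.
rewrite rungS.
apply: le_trans (level_step _ _ _ N_gt0 rho_ge0 CG_ge1 green_le _ K L n x (rung_gt0 j) K0) _.
rewrite ler_pM2l// ler_expR lerN2 -/t.
have KL := rung_cap_half n tau j (ltW tau0); rewrite -/K -/L in KL.
set p := 2 `^ (q + eta) in KL *; have p0 : 0 < p := p_gt0.
have tp : 4 * CG * p <= t.
  apply: le_trans t0_large _; rewrite /t rungE ler_peMr//.
  by rewrite exprn_ege1// ler1n.
(* [t0_large] is chosen so that the discount [2 CG K] takes at most half of [t K / p <= t L]. *)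
have step1 : K * t / (2 * p) <= t * L - 2 * CG * K.
  rewrite ler_pdivrMr ?mulr_gt0// mulrBl.
  have h1 := ler_wpM2l (ltW t0') KL; have h2 := ler_wpM2l (ltW K0) tp; lra.
apply: (@le_trans _ _ ((2 * CG * K `^ rho)^-1 * (K * t / (2 * p)))); last first.
  by apply: ler_wpM2l step1; rewrite invr_ge0 !mulr_ge0 ?powR_ge0// ltW.
have KE : K = K `^ rho * K `^ (1 - rho).
  by rewrite -powRD ?(gt_eqF K0) ?implybT// addrC subrK powRr1// ltW.
have Kr0 := powR_gt0 rho K0.
have -> : (2 * CG * K `^ rho)^-1 * (K * t / (2 * p)) = (4 * CG * p)^-1 * (K `^ (1 - rho) * t).
  rewrite [in K * t]KE; move: (K `^ rho) Kr0 (K `^ (1 - rho)) => a a0 b.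
  by field; rewrite !gt_eqF.
rewrite /rung_rate mulrAC mulrC -/p; apply: ler_wpM2l.
  by rewrite invr_ge0 !mulr_ge0 // ltW.
apply: (@le_trans _ _ ((c * (tau / t) `^ (q - eta)) `^ (1 - rho) * t)); last first.
  apply: ler_wpM2r; first exact: ltW.
  by apply: ge0_ler_powR => //; rewrite ?nnegrE ?(ltW rho1_gt0)// ?(ltW K0)// mulr_ge0
    ?powR_ge0// ltW.
rewrite powRM ?powR_ge0 ?(ltW c_gt0)// -mulrA ler_wpM2l ?powR_ge0//.
rewrite -powRrM (_ : (q - eta) * (1 - rho) = 1 + rung_exp); last by rewrite /rung_exp addrCA
  subrr addr0.
have tt : 0 < tau / t by rewrite divr_gt0.
rewrite [(tau / t) `^ _]powRD ?(gt_eqF tt) ?implybT// powRr1 ?(ltW tt)// mulrAC divfK ?gt_eqF//.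
rewrite ler_wpM2l ?(ltW tau0)//; apply: ge0_ler_powR; rewrite ?nnegrE ?(ltW rung_exp_gt0)
  ?(ltW tt)//.
  by rewrite divr_ge0// ltW.
by rewrite ler_wpM2l ?(ltW tau0)// lef_pV2.
Qed.

Definition rungs_hold (n : nat) (tau : R) (J : nat) (h : seq V) : bool :=
  all (fun j => (size (level (rung j) h))%:R <= rung_cap n tau j) (iota 0 J.+1).

(** Union bound over the first failing rung. Rung 0 cannot fail, its cap being at least [n]. *)
Lemma rungs_fail n tau y J x : 0 < tau -> (forall j, (j < J)%N -> (rung j)%:R <= y) ->
  walk_mean N n (fun _ h => (~~ rungs_hold n tau J h)%:R) x [::] <=
  J%:R * (2 * expR (- (rung_rate * (tau * (tau / y) `^ rung_exp)))).
Proof.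
move=> tau0; elim: J => [|J IH] Jy.
  rewrite mul0r -[leRHS](walk_mean_cst N N_gt0 n 0 x [::]).
  apply: walk_mean_le => z h; rewrite addn0 => hn.
  rewrite /rungs_hold /= andbT.
  suff -> : (size (level (rung 0) h))%:R <= rung_cap n tau 0 by [].
  rewrite /rung_cap powR1 mulr1; apply: (@le_trans _ _ n%:R); last first.
    by rewrite lerDl mulr_ge0 ?powR_ge0// ltW.
  by rewrite ler_nat -hn; apply: leq_trans (size_undup h); rewrite size_filter count_size.
rewrite -natr1 mulrDl mul1r.
apply: le_trans (lerD (IH (fun j jJ => Jy j (ltnW jJ))) (rung_fail n tau y J x tau0 (Jy J
  (ltnSn J)))).
rewrite -walk_meanD; apply: walk_mean_le => z h _.
have -> : rungs_hold n tau J.+1 h = rungs_hold n tau J h &&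
    ((size (level (rung J.+1) h))%:R <= rung_cap n tau J.+1).
  by rewrite /rungs_hold -addn1 iotaD all_cat /= andbT.
have [hJ|hJ] /= := boolP (rungs_hold n tau J h); last by rewrite lerDl.
rewrite add0r -ltNge.
move/allP: hJ => /(_ J); rewrite mem_iota add0n ltnS leqnn => /(_ isT) ->.
by [].
Qed.

Lemma powq_le_rungs jA J v : (rung jA <= v < rung J)%N ->
  powq q v <= \sum_(jA <= j < J) (rung j <= v)%N%:R * powq q (rung j.+1).
Proof.
have mono a b : (rung a < rung b)%N -> (a < b)%N.
  by rewrite /rung ltn_pmul2l ?t0_gt0// ltn_exp2l.
elim: J => [|J IH] /andP[Av vJ].
  by have := mono _ _ (leq_ltn_trans Av vJ).
have AJ : (jA <= J)%N by rewrite -ltnS; exact: mono (leq_ltn_trans Av vJ).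
rewrite big_nat_recr//=.
have [vJ'|Jv] := ltnP v (rung J).
  by rewrite mul0r addr0; apply: IH; rewrite Av.
rewrite mul1r -[leLHS]add0r lerD ?powq_le ?(ltnW vJ)//.
by apply: sumr_ge0 => j _; rewrite mulr_ge0 ?powq_ge0.
Qed.

Let beta : R := 2 `^ (- eta).
Let beta_gt0 : 0 < beta. Proof. exact: powR_gt0. Qed.
Let beta_lt1 : beta < 1.
Proof.
by rewrite /beta /powR gt_eqF// expR_lt1 mulNr oppr_lt0 mulr_gt0// ?ln_gt0 ?ltr1n.
Qed.

(** The purpose of [eta]: the first part decreases geometrically in [j] and the second increases
    geometrically, so their sums are governed by the lowest and by the highest rung respectively. *)
Lemma rung_term n tau j : 0 <= tau ->
  rung_cap n tau j * powq q (rung j.+1) =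
  n%:R * (2 * t0%:R) `^ q * beta ^+ j +
  c * 2 `^ q * tau `^ (q - eta) * (rung j)%:R `^ eta.
Proof.
move=> tau0; have t1 := rungR_gt0 j.
have x0 : 0 < 2 ^+ j :> R by rewrite exprn_gt0.
have betaE : beta ^+ j = (2 ^+ j) `^ (- eta).
  by rewrite /beta -powR_mulrn ?powR_ge0// -powRrM mulrC powRrM powR_mulrn.
rewrite /rung_cap /powq mulrDl; congr (_ + _).
  have -> : (rung j.+1)%:R = 2 * t0%:R * 2 ^+ j :> R by rewrite rungE exprS; ring.
  rewrite [in LHS]powRM ?mulr_ge0 ?(ltW x0)//.
  have -> : beta ^+ j = (2 ^+ j) `^ (- (q + eta)) * (2 ^+ j) `^ q.
    by rewrite betaE -powRD ?(gt_eqF x0) ?implybT//; congr (_ `^ _); lra.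
  by ring.
have -> : (rung j.+1)%:R = 2 * (rung j)%:R :> R by rewrite rungS natrM mulrC.
move: ((rung j)%:R : R) t1 => t t1.
have ti : t^-1 `^ (q - eta) = t `^ (- (q - eta)).
  by rewrite -powR_inv1 ?(ltW t1)// -powRrM mulN1r.
rewrite [(tau / t) `^ _]powRM ?invr_ge0 ?(ltW t1)// [(2 * t) `^ _]powRM ?(ltW t1)// ti.
have -> : t `^ eta = t `^ (- (q - eta)) * t `^ q.
  by rewrite -powRD ?(gt_eqF t1) ?implybT//; congr (_ `^ _); lra.
ring.
Qed.

Lemma sum_beta_le a b : \sum_(a <= j < b) beta ^+ j <= beta ^+ a / (1 - beta).
Proof.
have b1 : 0 < 1 - beta by rewrite subr_gt0.
rewrite ler_pdivlMr//.
have [ab|ba] := leqP a b; last first.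
  by rewrite big_geq ?(ltnW ba)// mul0r exprn_ge0// ltW.
suff -> : (\sum_(a <= j < b) beta ^+ j) * (1 - beta) = beta ^+ a - beta ^+ b.
  by rewrite gerBl exprn_ge0// ltW.
rewrite -(subnKC ab); elim: (b - a)%N => [|k IH].
  by rewrite addn0 big_geq// mul0r subrr.
by rewrite addnS big_nat_recr ?leq_addr//= mulrDl IH exprS; ring.
Qed.

Lemma sum_rung_powR_le y J : (forall j, (j < J)%N -> (rung j)%:R <= y) ->
  \sum_(j < J) (rung j)%:R `^ eta <= y `^ eta / (1 - beta).
Proof.
have b1 : 0 < 1 - beta by rewrite subr_gt0.
case: J => [|J] Jy; first by rewrite big_ord0 divr_ge0 ?powR_ge0// ltW.
rewrite ler_pdivlMr//; apply: (@le_trans _ _ ((rung J)%:R `^ eta)); last first.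
  have h := Jy J (ltnSn J); apply: ge0_ler_powR => //; rewrite ?nnegrE ?(ltW eta_gt0)//.
  exact: le_trans h.
elim: J {Jy} => [|J IH].
  by rewrite big_ord1 ler_piMr ?powR_ge0// gerBl ltW.
rewrite big_ord_recr /= mulrDl.
have e : (rung J)%:R `^ eta = beta * (rung J.+1)%:R `^ eta.
  by rewrite rungS natrM powRM// mulrCA /beta powRN mulVf ?mulr1 ?gt_eqF ?powR_gt0.
by apply: le_trans (lerD IH (lexx _)) _; rewrite e; lra.
Qed.

Lemma rungs_hold_sum n tau y jA J h : 0 <= y <= tau ->
  (forall j, (j < J)%N -> (rung j)%:R <= y) -> rungs_hold n tau J h ->
  occ_sum (fun _ v => if (rung jA <= v < rung J)%N then powq q v else 0) h <=
  n%:R * (2 * t0%:R) `^ q * (beta ^+ jA / (1 - beta)) + c * 2 `^ q / (1 - beta) * tau `^ q.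
Proof.
move=> /andP[y0 ytau] Jy hold; have tau0 := le_trans y0 ytau; have b1 : 0 < 1 - beta by
  rewrite subr_gt0.
apply: (@le_trans _ _ (\sum_(jA <= j < J) (size (level (rung j) h))%:R * powq q (rung j.+1))).
  under [leRHS]eq_bigr do rewrite size_level mulr_suml.
  rewrite exchange_big /=; apply: ler_sum => z _; case: ifP => [|_].
    exact: powq_le_rungs.
  by apply: sumr_ge0 => j _; rewrite mulr_ge0 ?powq_ge0.
apply: (@le_trans _ _ (\sum_(jA <= j < J) rung_cap n tau j * powq q (rung j.+1))).
  rewrite big_nat [leRHS]big_nat; apply: ler_sum => j /andP[_ jJ].
  apply: ler_wpM2r; first exact: powq_ge0.
  by have /allP/(_ j) := hold; rewrite mem_iota add0n ltnS (ltnW jJ); apply.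
under eq_bigr do rewrite rung_term//.
rewrite big_split /= -!mulr_sumr; apply: lerD.
  by rewrite ler_wpM2l ?sum_beta_le// mulr_ge0 ?powR_ge0.
have -> : tau `^ q = tau `^ (q - eta) * tau `^ eta.
  have [->|tau1] := eqVneq tau 0; first by rewrite !powR0 ?mulr0// gt_eqF.
  by rewrite -powRD ?tau1 ?implybT// subrK.
rewrite [leRHS](_ : _ = c * 2 `^ q * tau `^ (q - eta) * (tau `^ eta / (1 - beta))); last by ring.
apply: ler_wpM2l; first by rewrite !mulr_ge0 ?powR_ge0// ltW.
apply: (@le_trans _ _ (\sum_(j < J) (rung j)%:R `^ eta)).
  rewrite -[leRHS](big_mkord xpredT (fun j : nat => (rung j)%:R `^ eta)).
  have [ab|ba] := leqP jA J; last first.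
    apply: (@le_trans _ _ 0); first by rewrite big_geq// ltnW.
    by apply: sumr_ge0 => i _; exact: powR_ge0.
  rewrite [leRHS](big_cat_nat (n := jA))//= lerDr; apply: sumr_ge0 => i _; exact: powR_ge0.
apply: le_trans (sum_rung_powR_le y J Jy) _; apply: ler_wpM2r; first by rewrite invr_ge0 ltW.
by apply: ge0_ler_powR; rewrite ?nnegrE ?(ltW eta_gt0).
Qed.

(** The number of rungs is logarithmic in [y], but an affine bound suffices as a prefactor of an
    exponential. *)
Lemma first_rung (y : R) : 0 < y -> exists J, [/\ y <= (rung J)%:R,
  (forall j, (j < J)%N -> (rung j)%:R <= y) & J%:R <= y + 1].
Proof.
move=> y0.
have ex : exists J, y <= (rung J)%:R.
  exists (Num.truncn y).+1; apply/ltW; apply: lt_le_trans (truncnS_gt y) _.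
  rewrite ler_nat; apply: leq_trans (ltnW (ltn_expl _ (ltnSn 1))) _.
  by rewrite leq_pmull// t0_gt0.
exists (ex_minn ex); case: ex_minnP => J yJ min; split => //.
  by move=> j jJ; rewrite leNgt; apply/negP => /ltW /min; rewrite leqNgt jJ.
case: J yJ min => [|J] _ min; first by rewrite addr_ge0// ltW.
rewrite -natr1 lerD2r; apply/ltW; rewrite ltNge; apply/negP => yJ.
have /min : y <= (rung J)%:R; last by rewrite ltnn.
apply: le_trans yJ _; rewrite ler_nat; apply: leq_trans (ltnW (ltn_expl J (ltnSn 1))) _.
by rewrite leq_pmull// t0_gt0.
Qed.

Lemma middle_tail n tau y jA : 0 < y <= tau ->
  n%:R <= tau `^ q ->
  (2 * t0%:R) `^ q * (beta ^+ jA / (1 - beta)) <= 8^-1 -> c * 2 `^ q / (1 - beta) <= 8^-1 ->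
  walk_mean N n (fun _ h => (tau `^ q / 2 <=
    occ_sum (fun _ v => if (rung jA <= v)%N && (v%:R < y) then powq q v else 0) h)%R%:R) 0 [::] <=
  (y + 1) * (2 * expR (- (rung_rate * (tau * (tau / y) `^ rung_exp)))) :> R.
Proof.
move=> /andP[y0 ytau] ntau hA hc; have tau0 := lt_le_trans y0 ytau.
have [J [yJ Jy J1]] := first_rung y y0.
apply: (@le_trans _ _ (J%:R * (2 * expR (- (rung_rate * (tau * (tau / y) `^ rung_exp))))));
  last first.
  by rewrite ler_wpM2r// mulr_ge0// expR_ge0.
apply: le_trans (rungs_fail n tau y J 0 tau0 Jy); apply: walk_mean_le => x h _.
case: (boolP (rungs_hold n tau J h)) => [hold|_]; last by rewrite lern1 leq_b1.
suff -> : (tau `^ q / 2 <= occ_sum (fun _ v => if (rung jA <= v)%N && (v%:R < y) then powq q v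
  else 0) h) = false by [].
apply/negbTE; rewrite -ltNge.
have X0 : 0 < tau `^ q by exact: powR_gt0.
apply: (@le_lt_trans _ _ (occ_sum (fun _ v => if (rung jA <= v < rung J)%N then powq q v else
  0) h)).
  apply: occ_sum_le => z v _; case: ifP => [/andP[-> vy]|_].
    by rewrite ifT// -(ltr_nat R); exact: lt_le_trans yJ.
  by case: ifP => // _; exact: powq_ge0.
have := rungs_hold_sum n tau y jA J h _ Jy hold; rewrite (ltW y0) ytau => /(_ isT) h1.
apply: le_lt_trans h1 _; rewrite -mulrA.
have := ler_wpM2l (ler0n _ n) hA; have := ler_wpM2r (ltW X0) hc; lra.
Qed.

Lemma high_tail n tau jA : 0 < tau -> n%:R <= tau `^ q -> t0%:R `^ (q + eta) * tau `^ (- eta)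
  <= 2^-1 ->
  (2 * t0%:R) `^ q * (beta ^+ jA / (1 - beta)) <= 8^-1 -> c * 2 `^ q / (1 - beta) <= 8^-1 ->
  c <= 4^-1 ->
  walk_mean N n (fun _ h => (tau `^ q / 2 <=
    occ_sum (fun _ v => if (rung jA <= v)%N then powq q v else 0) h)%R%:R) 0 [::] <=
  (tau + 1) * (2 * expR (- (rung_rate * tau))) :> R.
Proof.
move=> tau0 ntau htau hA hc c4.
have [J [yJ Jy J1]] := first_rung tau tau0.
apply: (@le_trans _ _ (J%:R * (2 * expR (- (rung_rate * (tau * (tau / tau) `^ rung_exp))))));
  last first.
  by rewrite divff ?gt_eqF// powR1 mulr1 ler_wpM2r// mulr_ge0// expR_ge0.
apply: le_trans (rungs_fail n tau tau J 0 tau0 Jy); apply: walk_mean_le => x h _.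
case: (boolP (rungs_hold n tau J h)) => [hold|_]; last by rewrite lern1 leq_b1.
suff -> : (tau `^ q / 2 <= occ_sum (fun _ v => if (rung jA <= v)%N then powq q v else 0) h) =
  false by [].
apply/negbTE; rewrite -ltNge.
have X0 : 0 < tau `^ q by exact: powR_gt0.
(* A cap below 1 forces the top level to be empty, so when all rungs hold no site is visited
   [rung J] times. *)
have cap1 : rung_cap n tau J < 1.
  rewrite /rung_cap; have tJ := rungR_gt0 J.
  have h1 : c * (tau / (rung J)%:R) `^ (q - eta) <= c.
    rewrite -[leRHS]mulr1 ler_pM2l// -[leRHS](_ : 1 `^ (q - eta) = 1); last by rewrite powR1.
    apply: ge0_ler_powR; rewrite ?nnegrE ?(ltW s1_gt0)//; first by rewrite divr_ge0// ltW.
    by rewrite ler_pdivrMr// mul1r.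
  have t0R : 0 < t0%:R :> R by rewrite ltr0n t0_gt0.
  have x0 : 0 < 2 ^+ J :> R by rewrite exprn_gt0.
  (* From [n <= tau^q] and [2^J >= tau / t0] the term is at most [t0^(q + eta) tau^(- eta)]: this is
     where [tau] has to be large. *)
  have h2 : n%:R * (2 ^+ J) `^ (- (q + eta)) <= 2^-1.
    apply: le_trans htau.
    apply: (@le_trans _ _ (tau `^ q * (tau / t0%:R) `^ (- (q + eta)))).
      apply: ler_pM; rewrite ?powR_ge0// !powRN lef_pV2 ?posrE ?powR_gt0 ?divr_gt0//.
      apply: ge0_ler_powR; rewrite ?nnegrE ?(ltW s0_gt0) ?(ltW x0)//; first by rewrite
        divr_ge0// ltW.
      by rewrite ler_pdivrMr// mulrC -rungE.
    rewrite powRM ?invr_ge0 ?(ltW tau0)// -[t0%:R^-1]powR_inv1// -powRrM mulN1r opprK mulrA.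
    rewrite -powRD ?(gt_eqF tau0) ?implybT// mulrC.
    by rewrite (_ : q - (q + eta) = - eta)//; lra.
  lra.
have lev0 : size (level (rung J) h) = 0%N.
  apply/eqP; rewrite -leqn0 -ltnS -(ltr_nat R); apply: le_lt_trans cap1.
  by have /allP/(_ J) := hold; rewrite mem_iota add0n ltnS leqnn; apply.
have small z : (count_mem z h < rung J)%N.
  rewrite ltnNge -mem_level ?rung_gt0//; apply/negP => zin.
  by move: lev0; move: zin; case: (level _ _).
apply: (@le_lt_trans _ _ (occ_sum (fun _ v => if (rung jA <= v < rung J)%N then powq q v else
  0) h)).
  by apply: ler_sum => z _; rewrite small andbT.
have := rungs_hold_sum n tau tau jA J h _ Jy hold; rewrite (ltW tau0) lexx => /(_ isT) h1.
apply: le_lt_trans h1 _; rewrite -mulrA.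
have := ler_wpM2l (ler0n _ n) hA; have := ler_wpM2r (ltW X0) hc; lra.
Qed.

End Ladder.

(** * Upper tails on the scale of the theorem *)

Section WalkTails.
Context {R : realType} {V : zmodType} (N : seq V) (rho CG q : R).
Hypothesis N_gt0 : (0 < size N)%N.
Hypothesis rho_ge0 : 0 <= rho.
Hypothesis rho_lt1 : rho < 1.
Hypothesis CG_ge1 : 1 <= CG.
Hypothesis green_le : forall m x (s : seq V), uniq s ->
  \sum_(z <- s) green N m (x - z) <= CG * (size s)%:R `^ rho.
Hypothesis supercritical : 1 < q * (1 - rho).

Let rho1_gt0 : 0 < 1 - rho. Proof. by rewrite subr_gt0. Qed.
Let CG_gt0 : 0 < CG. Proof. exact: lt_le_trans CG_ge1. Qed.
Let q_gt1 : 1 < q.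
Proof.
have q0 : 0 < q by rewrite -(pmulr_lgt0 _ rho1_gt0) (lt_trans _ supercritical).
apply: lt_le_trans supercritical _; rewrite ler_piMr ?(ltW q0)//.
by rewrite gerBl.
Qed.
Let q_ge1 : 1 <= q. Proof. exact: ltW. Qed.
Let q_gt0 : 0 < q. Proof. exact: lt_le_trans q_ge1. Qed.

Lemma occupation_tails : exists (A : nat) (kappa zeta tau0 : R), [/\ 0 < kappa, 0 < zeta,
  forall n tau y, 0 < y <= tau -> n%:R <= tau `^ q ->
    walk_mean N n (fun _ h => (tau `^ q / 2 <=
      occ_sum (fun _ v => if (A <= v)%N && (v%:R < y) then powq q v else 0) h)%R%:R) 0 [::] <=
    (y + 1) * (2 * expR (- (kappa * (tau * (tau / y) `^ zeta)))) &
  forall n tau, 0 < tau -> tau0 <= tau -> n%:R <= tau `^ q ->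
    walk_mean N n (fun _ h => (tau `^ q / 2 <=
      occ_sum (fun _ v => if (A <= v)%N then powq q v else 0) h)%R%:R) 0 [::] <=
    (tau + 1) * (2 * expR (- (kappa * tau)))].
Proof.
(* Makes [q - eta] the midpoint of [q] and the critical exponent [(1 - rho)^-1]. *)
pose eta := (q - (1 - rho)^-1) / 2.
have r0 := rho1_gt0; have sc := supercritical; have cg := CG_gt0; have q0 := q_gt0.
have eta0 : 0 < eta.
  by rewrite divr_gt0// subr_gt0 -[ltLHS]mul1r ltr_pdivrMr.
have sup : 1 < (q - eta) * (1 - rho).
  rewrite (_ : (q - eta) * (1 - rho) = (q * (1 - rho) + 1) / 2); first by lra.
  by rewrite /eta; field; rewrite gt_eqF.
pose beta : R := 2 `^ (- eta).
have b0 : 0 < beta by exact: powR_gt0.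
have b1 : beta < 1.
  by rewrite /beta /powR gt_eqF// expR_lt1 mulNr oppr_lt0 mulr_gt0// ?ln_gt0 ?ltr1n.
have bb : 0 < 1 - beta by rewrite subr_gt0.
pose t0 := (Num.truncn (4 * CG * 2 `^ (q + eta))).+1.
have t0_large : 4 * CG * 2 `^ (q + eta) <= t0%:R by apply/ltW; exact: truncnS_gt.
(* The bound [1/4] keeps the top cap below 1; the other one limits the high rungs to [tau^q / 8]. *)
pose c := Num.min 4^-1 (8^-1 * (1 - beta) / 2 `^ q).
have p0 : 0 < 2 `^ q :> R by exact: powR_gt0.
have c0 : 0 < c by rewrite lt_min invr_gt0 ltr0n /= divr_gt0// mulr_gt0.
have c4 : c <= 4^-1 by rewrite ge_min lexx.
have hc : c * 2 `^ q / (1 - beta) <= 8^-1.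
  rewrite ler_pdivrMr// -ler_pdivlMr//.
  by rewrite ge_min lexx orbT.
pose D := (2 * t0%:R) `^ q / (1 - beta) * 8.
have D0 : 0 < D by rewrite mulr_gt0// divr_gt0// powR_gt0// mulr_gt0// ltr0n.
(* The first terms of the caps sum to [n] times a constant of order [beta^jA]. Starting the ladder
   at [jA] brings it down to [1/8], and sites visited fewer than [A = rung jA] times are left to the
   blocks. The choice works since [2^jA >= jA >= D^(1/eta)]. *)
pose jA := (Num.truncn (D `^ eta^-1)).+1.
have hA : (2 * t0%:R) `^ q * (beta ^+ jA / (1 - beta)) <= 8^-1.
  have -> : (2 * t0%:R) `^ q * (beta ^+ jA / (1 - beta)) = D * beta ^+ jA / 8.
    rewrite /D; move: (beta ^+ jA) ((2 * t0%:R) `^ q) (1 - beta) bb => u v w w0.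
    by field; rewrite gt_eqF.
  rewrite ler_pdivrMr// mulVf// -ler_pdivlMl// mulr1.
  have -> : beta ^+ jA = ((2 ^+ jA) `^ eta)^-1.
    by rewrite /beta -powR_mulrn ?powR_ge0// -powRrM mulNr powRN mulrC powRrM powR_mulrn.
  rewrite lef_pV2 ?posrE ?powR_gt0 ?exprn_gt0//.
  apply: (@le_trans _ _ ((D `^ eta^-1) `^ eta)).
    by rewrite -powRrM mulVf ?gt_eqF// powRr1// ltW.
  apply: ge0_ler_powR; rewrite ?nnegrE ?powR_ge0 ?exprn_ge0 ?(ltW eta0)//.
  apply: (@le_trans _ _ jA%:R); first by apply/ltW; exact: truncnS_gt.
  by rewrite -natrX ler_nat ltnW// ltn_expl.
exists (rung t0 jA), (rung_rate rho CG q eta c), (rung_exp rho q eta),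
  ((2 * t0%:R `^ (q + eta)) `^ eta^-1); split.
- exact: rung_rate_gt0.
- exact: rung_exp_gt0.
- move=> n tau y ytau ntau; exact: middle_tail.
- move=> n tau tau_gt0 tau0 ntau; apply: high_tail => //.
  move: tau0; have := powR_ge0 (t0%:R : R) (q + eta).
  move: (t0%:R `^ (q + eta)) => u u0 tau0.
  have h : 2 * u <= tau `^ eta.
    have -> : 2 * u = ((2 * u) `^ eta^-1) `^ eta.
      by rewrite -powRrM mulVf ?gt_eqF// powRr1// mulr_ge0.
    by apply: ge0_ler_powR; rewrite ?nnegrE ?powR_ge0 ?(ltW eta0) ?(ltW tau_gt0).
  by rewrite powRN ler_pdivrMr ?powR_gt0// -ler_pdivrMl ?invr_gt0// invrK.
Qed.

Lemma norm_pow_split A (h : seq V) :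
  norm_pow q h <= capped_pow q A h + occ_sum (fun _ v => if (A <= v)%N then powq q v else 0) h.
Proof.
rewrite /norm_pow /capped_pow /occ_sum -big_split; apply: ler_sum => z _ /=.
case: leqP => Av; first by rewrite lerDr powq_ge0.
by rewrite addr0.
Qed.

Lemma low_pow_split A (y : R) (h : seq V) :
  occ_sum (fun _ v => if v%:R < y then powq q v else 0) h <=
  capped_pow q A h + occ_sum (fun _ v => if (A <= v)%N && (v%:R < y) then powq q v else 0) h.
Proof.
rewrite /capped_pow /occ_sum -big_split; apply: ler_sum => z _ /=.
case: leqP => Av /=; case: ifP => _; rewrite ?addr0 ?powq_ge0//.
by rewrite lerDr powq_ge0.
Qed.

Lemma powR_eventually (a b c M : R) : 0 <= b -> b < a -> 0 < c ->
  exists n0, forall n, (n0 <= n)%N -> M * n%:R `^ b <= c * n%:R `^ a.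
Proof.
move=> b0 ba c0; have ab : 0 < a - b by rewrite subr_gt0.
pose K := Num.max 0 (M / c).
exists (Num.truncn (K `^ (a - b)^-1)).+1 => n n0.
have nR : 0 < n%:R :> R by rewrite ltr0n (leq_trans _ n0).
have -> : a = (a - b) + b by rewrite subrK.
rewrite powRD ?(gt_eqF nR) ?implybT// mulrA ler_wpM2r ?powR_ge0// mulrC -ler_pdivrMr//.
apply: (@le_trans _ _ K); first by rewrite le_max lexx orbT.
have K0 : 0 <= K by rewrite le_max lexx.
apply: (@le_trans _ _ ((K `^ (a - b)^-1) `^ (a - b))).
  by rewrite -powRrM mulVf ?gt_eqF// powRr1.
apply: ge0_ler_powR; rewrite ?nnegrE ?powR_ge0 ?(ltW ab)//.
by apply/ltW; apply: lt_le_trans (truncnS_gt _) _; rewrite ler_nat.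
Qed.

Lemma root_eventually (M : R) : exists n0, forall n, (n0 <= n)%N -> M <= n%:R `^ q^-1.
Proof.
have qi : 0 < q^-1 by rewrite invr_gt0.
have [n0 h] := powR_eventually q^-1 0 1 M (lexx 0) qi ltr01.
exists n0 => n /h; by rewrite powRr0 mulr1 mul1r.
Qed.

Lemma affine_le_exp (k t : R) : 0 < k -> 1 <= t -> 64 / k ^+ 2 <= t ->
  4 * (t + 1) * expR (- (k * t)) <= expR (- (k / 2 * t)).
Proof.
move=> k0 t1 kt; have t0 : 0 < t by exact: lt_le_trans t1.
have -> : - (k * t) = - (k / 2 * t) - k / 2 * t by field.
rewrite expRD mulrA mulrAC -[leRHS]mul1r ler_wpM2r ?expR_ge0//.
rewrite expRN ler_pdivrMr ?expR_gt0// mul1r.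
have x0 : 0 <= k / 2 * t by rewrite mulr_ge0 ?divr_ge0 ?(ltW k0)// ltW.
apply: le_trans (expR_ge1Dxn 1 x0).
rewrite (_ : 2`! = 2)%N//.
have : 64 * t <= k ^+ 2 * t ^+ 2.
  by rewrite [t ^+ 2]expr2 mulrA ler_wpM2r ?(ltW t0)// mulrC -ler_pdivrMr ?exprn_gt0.
have -> : (k / 2 * t) ^+ 2 / 2 = (k ^+ 2 * t ^+ 2) / 8 by field.
lra.
Qed.

(** Supercriticality also reads [1/q < 1 - rho], which makes the low sites negligible at scale
    [n^(1/q)]. The factor 8 leaves them half of the final bound, their tail having the constant
    4. *)
Let superpoly (c M : R) : 0 < c -> exists n0, forall n, (n0 <= n)%N ->
  8 * expR (- (c * n%:R `^ (1 - rho))) <= expR (- (M * n%:R `^ q^-1)).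
Proof.
move=> c0; have qi : q^-1 < 1 - rho by rewrite -[ltLHS]mul1r ltr_pdivrMr// mulrC.
have qi0 : 0 <= q^-1 by rewrite invr_ge0 ltW.
have [n1 h1] := powR_eventually (1 - rho) q^-1 c (M + 7) qi0 qi c0.
have [n2 h2] := root_eventually 1.
exists (maxn n1 n2) => n; rewrite geq_max => /andP[/h1 {}h1 /h2 {}h2].
have e8 : 8 <= expR (7 * n%:R `^ q^-1) :> R.
  by apply: le_trans (expR_ge1Dx _); lra.
apply: le_trans (ler_wpM2r (expR_ge0 _) e8) _.
by rewrite -expRD ler_expR; lra.
Qed.

Lemma norm_pow_upper_tail : exists2 cp : R, 0 < cp & forall xi, 1 <= xi ->
  exists n0, forall n, (n0 <= n)%N ->
    walk_mean N n (fun _ h => (walk_mean N n (fun _ h => norm_pow q h) 0 [::] + xi * n%:R <=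
      norm_pow q h)%R%:R) 0 [::] <= expR (- cp * (xi * n%:R) `^ q^-1) :> R.
Proof.
have [A [kappa [zeta [tau0 [k0 z0 _ high]]]]] := occupation_tails.
have [c c0 low] := low_occupation_tail _ _ _ _ N_gt0 rho_ge0 rho_lt1 CG_ge1 green_le q_ge1 A.
(* Half of the rate absorbs the prefactor [tau + 1]. The constant is free of [xi] because the ladder
   is run with [tau^q = xi n >= n]. *)
exists (kappa / 2); first by rewrite divr_gt0.
move=> xi xi1; have xi0 : 0 < xi by exact: lt_le_trans xi1.
have [n1 h1] := superpoly c (kappa / 2 * xi `^ q^-1) c0.
have [n2 h2] := root_eventually (Num.max (Num.max 1 tau0) (64 / kappa ^+ 2)).
exists (maxn 1 (maxn n1 n2)) => n; rewrite !geq_max => /and3P[n_gt0 /h1 {}h1 /h2 {}h2].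
have nR : 0 < n%:R :> R by rewrite ltr0n.
set tau := (xi * n%:R) `^ q^-1.
have tauE : tau = xi `^ q^-1 * n%:R `^ q^-1 by rewrite /tau powRM// ltW.
have tauq : tau `^ q = xi * n%:R.
  by rewrite /tau -powRrM mulVf ?gt_eqF// powRr1// mulr_ge0// ltW.
have tau_ge : n%:R `^ q^-1 <= tau.
  by apply: ge0_ler_powR; rewrite ?nnegrE ?invr_ge0 ?(ltW q_gt0) ?mulr_ge0 ?(ltW xi0)// ler_peMl.
move: h2; rewrite !ge_max => /andP[/andP[h21 h22] h23].
have tau1 := le_trans h21 tau_ge; have tau_gt0 : 0 < tau by exact: lt_le_trans tau1.
set E := walk_mean N n (fun _ h => norm_pow q h) 0 [::].
pose hi h : R := occ_sum (fun _ v => if (A <= v)%N then powq q v else 0) (h : seq V).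
apply: (@le_trans _ _ (walk_mean N n (fun _ h => (E + n%:R / 2 <= capped_pow q A h)%R%:R +
    (tau `^ q / 2 <= hi h)%R%:R) 0 [::])).
  have le1 (b : bool) : b%:R <= 1 :> R by rewrite lern1 leq_b1.
  apply: walk_mean_le => y h _.
  case: (boolP (E + n%:R / 2 <= _)) => hb.
    by apply: le_trans (le1 _) _; rewrite lerDl.
  rewrite add0r; case: (boolP (tau `^ q / 2 <= _)) => hv; first exact: le1.
  rewrite -!ltNge in hb hv.
  suff -> : (E + xi * n%:R <= norm_pow q h) = false by [].
  apply/negbTE; rewrite -ltNge; apply: le_lt_trans (norm_pow_split A h) _.
  have : n%:R <= xi * n%:R by rewrite ler_peMl// ltW.
  rewrite tauq in hv; rewrite -/(hi h); lra.
rewrite walk_meanD.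
have b1 := low n n_gt0; rewrite -/E in b1.
have ntau : n%:R <= tau `^ q by rewrite tauq ler_peMl// ltW.
have b2 := high n tau tau_gt0 (le_trans h22 tau_ge) ntau.
have b3 := affine_le_exp kappa tau k0 tau1 (le_trans h23 tau_ge).
rewrite -mulrA -tauE in h1; rewrite mulNr -/tau.
rewrite -/hi in b2; move: b2 b3 h1 b1.
move: (expR (- (kappa * tau))) (expR (- (kappa / 2 * tau))) (expR (- (c * _))) => *; lra.
Qed.

Lemma low_pow_upper_tail (xi M : R) : 1 <= xi ->
  exists2 e0 : R, 0 < e0 & forall eps, 0 < eps < e0 ->
  exists n0, forall n, (n0 <= n)%N ->
    walk_mean N n (fun _ h => (walk_mean N n (fun _ h => norm_pow q h) 0 [::] + xi * n%:R <=
      occ_sum (fun _ v => if v%:R < eps * n%:R `^ q^-1 then powq q v else 0) h)%R%:R) 0 [::]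
    <= expR (- (M * n%:R `^ q^-1)) :> R.
Proof.
move=> xi1; have xi0 : 0 < xi by exact: lt_le_trans xi1.
have [A [kappa [zeta [tau0 [k0 z0 mid _]]]]] := occupation_tails.
have [c c0 low] := low_occupation_tail _ _ _ _ N_gt0 rho_ge0 rho_lt1 CG_ge1 green_le q_ge1 A.
(* Doubling [M] pays for the prefactor [nu + 1]; the 1 keeps [M'] positive for any [M]. *)
pose M' := Num.max 1 (2 * M).
have M'1 : 1 <= M' by rewrite le_max lexx.
have M'0 : 0 < M' by exact: lt_le_trans M'1.
(* Here [tau / y >= eps^-1], so the middle sites have exponent at least
   [kappa eps^(- zeta) n^(1/q)], which reaches [M' n^(1/q)] for [eps] below [e1]. *)
pose e1 := (kappa / M') `^ zeta^-1.
have e10 : 0 < e1 by rewrite powR_gt0// divr_gt0.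
exists (Num.min 1 e1); first by rewrite lt_min ltr01.
move=> eps /andP[eps0]; rewrite lt_min => /andP[eps1 epse].
have [n1 h1] := superpoly c M c0.
have [n2 h2] := root_eventually (Num.max 1 (64 / M' ^+ 2)).
exists (maxn 1 (maxn n1 n2)) => n; rewrite !geq_max => /and3P[n_gt0 /h1 {}h1 /h2 {}h2].
have nR : 0 < n%:R :> R by rewrite ltr0n.
move: h2; rewrite ge_max => /andP[h21 h22].
set nu := n%:R `^ q^-1 in h1 h21 h22 *; have nu0 : 0 < nu by exact: powR_gt0.
pose tau := (xi * n%:R) `^ q^-1; pose y := eps * nu.
have y0 : 0 < y by rewrite mulr_gt0.
have tauq : tau `^ q = xi * n%:R.
  by rewrite /tau -powRrM mulVf ?gt_eqF// powRr1// mulr_ge0// ltW.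
have tau_ge : nu <= tau.
  by apply: ge0_ler_powR; rewrite ?nnegrE ?invr_ge0 ?(ltW q_gt0) ?mulr_ge0 ?(ltW xi0)// ler_peMl.
have ynu : y <= nu by rewrite /y ler_piMl ?(ltW nu0)// ltW.
have ytau : 0 < y <= tau by rewrite y0 (le_trans ynu).
set E := walk_mean N n (fun _ h => norm_pow q h) 0 [::].
pose mi h : R := occ_sum (fun _ v => if (A <= v)%N && (v%:R < y) then powq q v else 0) (h : seq V).
apply: (@le_trans _ _ (walk_mean N n (fun _ h => (E + n%:R / 2 <= capped_pow q A h)%R%:R +
    (tau `^ q / 2 <= mi h)%R%:R) 0 [::])).
  have le1 (b : bool) : b%:R <= 1 :> R by rewrite lern1 leq_b1.
  apply: walk_mean_le => x h _.
  case: (boolP (E + n%:R / 2 <= _)) => hb.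
    by apply: le_trans (le1 _) _; rewrite lerDl.
  rewrite add0r; case: (boolP (tau `^ q / 2 <= _)) => hv; first exact: le1.
  rewrite -!ltNge in hb hv; rewrite -/y.
  suff -> : (E + xi * n%:R <= occ_sum (fun _ v => if v%:R < y then powq q v else 0) h) = false
    by [].
  apply/negbTE; rewrite -ltNge; apply: le_lt_trans (low_pow_split A y h) _.
  have : n%:R <= xi * n%:R by rewrite ler_peMl// ltW.
  rewrite tauq in hv; rewrite -/(mi h); lra.
rewrite walk_meanD.
have b1 := low n n_gt0; rewrite -/E in b1.
have ntau : n%:R <= tau `^ q by rewrite tauq ler_peMl// ltW.
have b2 := mid n tau y ytau ntau.
have rate : M' * nu <= kappa * (tau * (tau / y) `^ zeta).
  rewrite mulrCA mulrC; apply: ler_pM => //; first exact: ltW.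
    exact: ltW.
  rewrite -ler_pdivrMl// mulrC.
  have -> : M' / kappa = (e1 `^ zeta)^-1.
    by rewrite /e1 -powRrM mulVf ?gt_eqF// powRr1 ?invf_div// divr_ge0 ?ltW.
  rewrite -powRN -mulN1r powRrM powR_inv1 ?(ltW e10)//.
  apply: ge0_ler_powR; rewrite ?nnegrE ?invr_ge0 ?(ltW z0) ?(ltW e10)//.
    by rewrite divr_ge0 ?(ltW y0)// (le_trans _ tau_ge)// ltW.
  rewrite ler_pdivlMr// /y mulrA; apply: le_trans tau_ge.
  by rewrite ler_piMl ?(ltW nu0)// mulrC ler_pdivrMr// mul1r ltW.
have b3 := affine_le_exp M' nu M'0 h21 h22.
have e4 : expR (- (kappa * (tau * (tau / y) `^ zeta))) <= expR (- (M' * nu)).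
  by rewrite ler_expR lerN2.
have e5 : expR (- (M' / 2 * nu)) <= expR (- (M * nu)).
  rewrite ler_expR lerN2 ler_wpM2r ?(ltW nu0)// ler_pdivlMr// mulrC.
  by rewrite le_max lexx orbT.
have e6 : (y + 1) * (2 * expR (- (kappa * (tau * (tau / y) `^ zeta)))) <=
    (nu + 1) * (2 * expR (- (M' * nu))).
  apply: ler_pM.
  - by rewrite addr_ge0 ?(ltW y0).
  - by rewrite mulr_ge0 ?expR_ge0.
  - by rewrite lerD2r.
  - by rewrite ler_wpM2l.
rewrite -/mi in b2; move: b2 b3 h1 b1 e5 e6.
move: (expR (- (kappa * (tau * _)))) (expR (- (M' * nu))) (expR (- (M' / 2 * nu)))
  (expR (- (c * _))) (expR (- (M * _))) => *; lra.
Qed.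

End WalkTails.

(** * From path averages to probabilities *)
Section Bridge.
Context {disp : measure_display} {T : measurableType disp} {R : realType}
  (P : probability T R) (d : nat) (S : nat -> T -> 'rV[int]_d).
Hypothesis SRW : simple_random_walk P S.
Hypothesis d_gt0 : (0 < d)%N.
Local Notation V := 'rV[int]_d.
Local Notation N := (lattice_steps d).

Fixpoint history (n : nat) (w : T) : seq V :=
  if n is m.+1 then S m w :: history m w else [::].

(** Quantifying over all [Q] carries the induction: the current site is fixed to one of countably
    many values, which is then passed into the predicate. *)
Lemma measurable_history n (Q : V -> seq V -> Prop) :
  measurable [set w | Q (S n w) (history n w)].
Proof.
elim: n Q => [|n IH] Q; first exact: (srw_rv SRW 0%N [set x | Q x [::]]).
have -> : [set w | Q (S n.+1 w) (history n.+1 w)] =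
    \bigcup_(v in [set: V]) ((S n.+1 @^-1` [set v]) `&` [set w | Q v (S n w :: history n w)]).
  apply/seteqP; split => w /=; first by move=> Qw; exists (S n.+1 w).
  by case=> v _ [/= <-].
apply: countable_bigcupT_measurable => // v.
apply: measurableI; first exact: (srw_rv SRW).
exact: (IH (fun x h => Q v (x :: h))).
Qed.

Lemma measurable_fun_history n (f : V -> seq V -> R) :
  measurable_fun [set: T] ((fun w => (f (S n w) (history n w))%:E) : T -> \bar R).
Proof.
move=> _ B mB; rewrite setTI.
exact: (measurable_history n (fun x h => B (f x h)%:E)).
Qed.

(* Words list the steps latest first. *)
Fixpoint word_pos (u : seq V) : V := if u is e :: u' then word_pos u' + e else 0.
Fixpoint word_sites (u : seq V) : seq V :=
  if u is e :: u' then word_pos u' :: word_sites u' else [::].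

Definition cylinder (u : seq V) : set T :=
  [set w | forall k, (k < size u)%N -> step S k w = nth 0 (rev u) k].

Lemma cylinder_cons e u :
  cylinder (e :: u) = cylinder u `&` (step S (size u) @^-1` [set e]).
Proof.
apply/seteqP; split => w /=.
  move=> h; split => [k ku|].
    by rewrite h ?ltnS ?(ltnW ku)// rev_cons nth_rcons size_rev ku.
  by rewrite h//= rev_cons nth_rcons size_rev ltnn eqxx.
move=> [h he] k; rewrite ltnS leq_eqVlt rev_cons nth_rcons size_rev => /predU1P[->|ku].
  by rewrite ltnn eqxx.
by rewrite ku h.
Qed.

Lemma cylinder_path u w : cylinder u w ->
  S (size u) w = word_pos u /\ history (size u) w = word_sites u.
Proof.
elim: u => [|e u IH] /=; first by rewrite (srw_start SRW).
rewrite cylinder_cons => -[/IH[Su ->]] /= se; split; last by rewrite Su.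
by rewrite -Su -se /step addrC subrK.
Qed.

Lemma measurable_step k A : measurable (step S k @^-1` A).
Proof.
have := measurable_history k.+1 (fun x h => A (x - head 0 h)).
by [].
Qed.

Lemma measurable_cylinder u : measurable (cylinder u).
Proof.
elim: u => [|e u IH]; last by rewrite cylinder_cons; apply: measurableI => //; exact:
  measurable_step.
have -> : cylinder [::] = setT by apply/seteqP; split.
exact: measurableT.
Qed.

Lemma mem_lattice_steps z : (z \in N) = origin_neighbour z.
Proof.
apply/idP/idP.
  have one (c : 'I_d) : origin_neighbour (delta_mx ord0 c).
    rewrite /origin_neighbour (bigD1 c)//= big1 => [|b bc]; last by rewrite mxE (negbTE bc).
    by rewrite mxE !eqxx.
  rewrite mem_cat => /orP[] /mapP[c _ ->]; first exact: one.
  have := one c; rewrite /origin_neighbour; apply: etrans; congr (_ == _).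
  by apply: eq_bigr => b _; rewrite mxE abszN.
rewrite /origin_neighbour => /eqP z1.
have [c zc] : exists c, z ord0 c != 0.
  apply/existsP; rewrite -[X in is_true X]negbK negb_exists; apply/negP => /forallP z0.
  by move: z1; rewrite big1// => c _; have := z0 c; rewrite negbK => /eqP ->.
move: z1; rewrite (bigD1 c)//= => z1.
have [zc1 rest] : `|z ord0 c|%N = 1%N /\ (\sum_(i < d | i != c) `|z ord0 i| = 0)%N.
  move: zc z1; rewrite -absz_gt0; move: (absz (z ord0 c)) (\sum_(i < d | i != c) absz (z ord0
    i))%N => a b; lia.
have others b : b != c -> z ord0 b = 0.
  move=> bc; apply/eqP; rewrite -absz_eq0; move/eqP: rest.
  by rewrite sum_nat_eq0 => /forallP/(_ b); rewrite bc.
rewrite mem_cat; apply/orP; have [zpos|zneg] := leP 0 (z ord0 c); [left|right].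
  apply/mapP; exists c; first by rewrite mem_index_enum.
  apply/rowP => b; rewrite mxE /=; case: (b =P c) => [->|/eqP/others ->//].
  by rewrite -(gez0_abs zpos) zc1.
apply/mapP; exists c; first by rewrite mem_index_enum.
apply/rowP => b; rewrite !mxE /=; case: (b =P c) => [->|/eqP/others ->]; last by rewrite oppr0.
by rewrite -[LHS]opprK -(ltz0_abs zneg) zc1.
Qed.

Lemma uniq_lattice_steps : uniq N.
Proof.
have inj : injective (fun c : 'I_d => delta_mx ord0 c : V).
  by move=> a b /rowP/(_ a); rewrite !mxE !eqxx /=; case: eqP.
rewrite cat_uniq !map_inj_uniq ?index_enum_uniq//=; last first.
  by move=> a b /oppr_inj /inj.
rewrite andbT; apply/hasPn => _ /mapP[c _ ->]; apply/negP => /mapP[b _].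
by move=> /rowP/(_ c); rewrite !mxE !eqxx /=; case: eqP.
Qed.

Lemma step_prob k e : e \in N -> P (step S k @^-1` [set e]) = ((d.*2%:R)^-1)%:E.
Proof. by move=> eN; rewrite (srw_step SRW) -mem_lattice_steps eN. Qed.

Lemma cylinder_prob u : all (mem N) u -> P (cylinder u) = (((d.*2%:R)^-1) ^+ size u)%:E.
Proof.
move=> uN.
pose I := [fset k in iota 0 (size u)]%fset.
have IE k : (k \in I) = (k < size u)%N by rewrite !inE mem_iota add0n.
pose A k := [set nth 0 (rev u) k] : set V.
have -> : cylinder u = \bigcap_(k in [set` I]) (step S k @^-1` A k).
  apply/seteqP; split => w h k.
    by rewrite /= IE => ku; apply: h.
  by move=> ku; apply: h; rewrite /= IE.
rewrite (srw_indep SRW) big_seq.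
transitivity (\prod_(k <- I | k \in I) ((d.*2%:R)^-1)%:E : \bar R)%E.
  apply: eq_bigr => k; rewrite IE => ku; rewrite /A step_prob//.
  by apply: (allP uN); rewrite -mem_rev mem_nth// size_rev.
rewrite -big_seq prodEFin.
have : perm_eq (enum_fset I) (iota 0 (size u)).
  apply: uniq_perm; [exact: fset_uniq|exact: iota_uniq|].
  by move=> k; rewrite -[LHS]/(k \in I) IE mem_iota add0n.
move=> /(perm_big _) ->.
by rewrite big_const_seq count_predT size_iota -Monoid.iteropE.
Qed.

Lemma step_off_lattice k : P (step S k @^-1` [set z | z \notin N]) = 0%E.
Proof.
have -> : step S k @^-1` [set z | z \notin N] = ~` (step S k @^-1` [set z | z \in N]).
  by apply/seteqP; split => w /=; [move=> /negP|move=> /negP].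
rewrite probability_setC; last exact: measurable_step.
have -> : step S k @^-1` [set z | z \in N] = \bigcup_(e in [set` N]) (step S k @^-1` [set e]).
  by apply/seteqP; split => w /=; [exists (step S k w)|case=> e /= eN ->].
rewrite measure_fin_bigcup; last 3 first.
- exact: finite_seq.
- by move=> a b _ _ [w [/= <- <-]].
- by move=> e _; exact: measurable_step.
rewrite -fsbig_seq ?uniq_lattice_steps// big_seq.
rewrite (eq_bigr (fun=> ((d.*2%:R)^-1)%:E)) => [|e eN]; last exact: step_prob.
rewrite -big_seq sumEFin big_const_seq count_predT size_lattice_steps iter_addr_0.
rewrite -[_ *+ d.*2]mulr_natl mulfV ?subee// pnatr_eq0 -lt0n double_gt0.
exact: d_gt0.
Qed.

(** Induction on the steps left, for all cylinders at once: splitting by the next step turns the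
    integral into the average that defines [walk_mean]. *)
Lemma integral_cylinder (f : V -> seq V -> R) m u : (forall x h, 0 <= f x h) ->
  all (mem N) u ->
  (\int[P]_(w in cylinder u) (f (S (size u + m) w) (history (size u + m) w))%:E =
  ((d.*2%:R)^-1 ^+ size u * walk_mean N m f (word_pos u) (word_sites u))%:E)%E.
Proof.
move=> f0; elim: m u => [|m IH] u uN.
  rewrite addn0 (eq_integral (cst (f (word_pos u) (word_sites u))%:E)).
    transitivity ((f (word_pos u) (word_sites u))%:E * P (cylinder u))%E.
      by rewrite -integral_cst//; exact: measurable_cylinder.
    by rewrite cylinder_prob// -EFinM mulrC.
  by move=> w /set_mem/cylinder_path[-> ->].
set k := size u; set F := (fun w : T => (f (S (k + m.+1) w) (history (k + m.+1) w))%:E) : T ->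
  \bar R.
have mF D : measurable_fun D F.
  by apply: measurable_funS (measurable_fun_history _ _) => //; exact: measurableT.
have F0 w : (0 <= F w)%E by rewrite lee_fin.
(* Only the law of the steps is prescribed, so a null set of paths may take other steps; it is split
   off. *)
have -> : cylinder u = (\big[setU/set0]_(e <- N) cylinder (e :: u)) `|`
    (cylinder u `&` (step S k @^-1` [set z | z \notin N])).
  rewrite -bigcup_seq; apply/seteqP; split => w /=.
    move=> cw; have [sN|sN] := boolP (step S k w \in N); [left|right] => //.
    by exists (step S k w) => //; rewrite cylinder_cons.
  by move=> [[e _]|[]//]; rewrite cylinder_cons => -[].
have mc e : measurable (cylinder (e :: u)) by exact: measurable_cylinder.
rewrite ge0_integral_setU//; last 4 first.
- by apply: bigsetU_measurable => e _; exact: mc.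
- by apply: measurableI; [exact: measurable_cylinder|exact: measurable_step].
- by move=> w _; rewrite lee_fin.
- apply/disj_setPS => w /= [+ [_ wN]]; rewrite -bigcup_seq => -[e /= eN].
  by rewrite cylinder_cons => -[_ /= we]; move: wN; rewrite we eN.
rewrite [X in (_ + X)%E]null_set_integral ?adde0//; last 2 first.
- by apply: measurableI; [exact: measurable_cylinder|exact: measurable_step].
- apply/eqP; rewrite -measure_le0 -(step_off_lattice k).
  apply: le_measure; rewrite ?inE; [|exact: measurable_step|by move=> ? []].
  by apply: measurableI; [exact: measurable_cylinder|exact: measurable_step].
rewrite ge0_integral_bigsetU ?uniq_lattice_steps//; last 2 first.
- by move=> a b _ _ [w []]; rewrite !cylinder_cons => -[_ /= <-] [_ /= <-].
- by move=> w _; rewrite lee_fin.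
rewrite big_seq (eq_bigr (fun e => ((d.*2%:R)^-1 ^+ k.+1 *
  walk_mean N m f (word_pos u + e) (word_pos u :: word_sites u))%:E)) => [|e eN]; last first.
  by rewrite /F -addSnnS; apply: (IH (e :: u)); rewrite /= eN.
rewrite -big_seq sumEFin -mulr_sumr /= /avg size_lattice_steps exprSr.
by rewrite mulrA.
Qed.

Lemma integral_history (f : V -> seq V -> R) n : (forall x h, 0 <= f x h) ->
  (\int[P]_w (f (S n w) (history n w))%:E = (walk_mean N n f 0 [::])%:E)%E.
Proof.
move=> f0; have := integral_cylinder f n [::] f0 isT; rewrite /= expr0 mul1r add0n => <-.
by congr (integral _ _ _); apply/seteqP; split.
Qed.

Lemma prob_history (A : V -> seq V -> bool) n :
  P [set w | A (S n w) (history n w)] =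
  (walk_mean N n (fun x h => (A x h)%:R) 0 [::])%:E.
Proof.
rewrite -integral_history => [|x h]; last exact: ler0n.
have mA := measurable_history n A.
rewrite -[X in P X](setIT _) -integral_indic//.
by apply: eq_integral => w _; rewrite indicE mem_setE.
Qed.

Lemma local_time_history n z w : local_time S n z w = count_mem z (history n w).
Proof.
rewrite /local_time; elim: n => [|n IH]; first by rewrite big_geq.
by rewrite big_nat_recr//= IH addnC.
Qed.

Lemma occ_sum_fsbig (phi : nat -> R) n w : phi 0%N = 0 ->
  \sum_(z \in [set: V]) phi (local_time S n z w) = occ_sum (fun _ v => phi v) (history n w).
Proof.
move=> phi0; rewrite (fsbigE (undup (history n w)))//; last 2 first.
- exact: undup_uniq.
- move=> z _; rewrite mem_undup => zh.
  by rewrite local_time_history (count_memPn zh).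
rewrite /occ_sum; apply: eq_big => [z|z _]; first by rewrite in_setT.
by rewrite local_time_history.
Qed.

Lemma norm_q_powE (q : R) n w : q != 0 -> norm_q_pow S q n w = norm_pow q (history n w).
Proof. by move=> q0; rewrite /norm_q_pow (occ_sum_fsbig (powq q))// /powq powR0. Qed.

Lemma low_norm_q_powE (q b : R) n w : q != 0 -> low_norm_q_pow S q b n w =
  occ_sum (fun _ v => if v%:R < b then powq q v else 0) (history n w).
Proof.
move=> q0; rewrite -occ_sum_fsbig; last by rewrite /powq powR0 ?if_same.
apply: eq_fsbigr => z _; rewrite indicE.
case: ifP => h; first by rewrite mem_set// mul1r.
by rewrite memNset ?mul0r//= h.
Qed.

Lemma mean_norm_q_pow (q : R) n : q != 0 ->
  ('E_P[norm_q_pow S q n] = (walk_mean N n (fun _ h => norm_pow q h) 0 [::])%:E)%E.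
Proof.
move=> q0; rewrite unlock -integral_history => [|x h]; last exact: norm_pow_ge0.
by apply: eq_integral => w _; rewrite norm_q_powE.
Qed.

End Bridge.

(** * Oscillating walks *)
Section LowerTail.
Context {R : realType} {V : zmodType} (N : seq V).
Hypothesis N_gt0 : (0 < size N)%N.

Lemma walk_mean_one_step n (f : V -> seq V -> R) x h e : (forall y g, 0 <= f y g) ->
  e \in N -> (size N)%:R^-1 * walk_mean N n f (x + e) (x :: h) <= walk_mean N n.+1 f x h.
Proof.
move=> f0 eN; rewrite /= /avg ler_wpM2l ?invr_ge0//.
rewrite (big_rem e)//= lerDl sumr_ge0// => z _; exact: walk_mean_ge0.
Qed.

Lemma walk_mean_zigzag k m (f : V -> seq V -> R) e h : (forall y g, 0 <= f y g) ->
  e \in N -> - e \in N ->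
  (size N)%:R^-1 ^+ k.*2 * walk_mean N m f 0 (flatten (nseq k [:: e; 0]) ++ h) <=
  walk_mean N (k.*2 + m) f 0 h.
Proof.
move=> f0 eN eN'; elim: k h => [|k IH] h; first by rewrite expr0 mul1r.
rewrite doubleS !exprS -!mulrA.
apply: le_trans (walk_mean_one_step (k.*2.+1 + m) f 0 h e f0 eN).
rewrite ler_wpM2l ?invr_ge0//.
apply: le_trans (walk_mean_one_step (k.*2 + m) f (0 + e) (0 :: h) (- e) f0 eN').
rewrite ler_wpM2l ?invr_ge0// add0r subrr.
have -> : flatten (nseq k.+1 [:: e; 0]) ++ h = flatten (nseq k [:: e; 0]) ++ [:: e, 0 & h].
  by rewrite -[k.+1]addn1 nseqD flatten_cat -catA.
exact: IH.
Qed.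

Lemma powq_count_le (q : R) x (h : seq V) : 1 <= q -> powq q (count_mem x h) <= norm_pow q h.
Proof.
move=> q1; case: (boolP (x \in h)) => [xh|/count_memPn ->].
  rewrite /norm_pow /occ_sum (bigD1_seq x) ?mem_undup ?undup_uniq//=.
  by rewrite lerDl sumr_ge0// => z _; exact: powq_ge0.
by rewrite powq0// norm_pow_ge0.
Qed.

(** The first [2k] steps are forced and give [k] visits to 0; whatever the walk does later only
    increases the norm. *)
Lemma norm_pow_prob_ge (q b : R) e k n : 1 <= q -> e \in N -> - e \in N ->
  (k.*2 <= n)%N -> b <= powq q k ->
  (size N)%:R^-1 ^+ k.*2 <= walk_mean N n (fun _ h => (b <= norm_pow q h)%R%:R) 0 [::] :> R.
Proof.
move=> q1 eN eN' kn bk; rewrite -(subnKC kn).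
apply: le_trans (walk_mean_zigzag k (n - k.*2) _ e [::] _ eN eN'); last by [].
rewrite -[leLHS]mulr1 ler_wpM2l ?exprn_ge0 ?invr_ge0// cats0.
have := walk_mean_shift N (n - k.*2) (fun _ h => (b <= norm_pow q h)%R%:R : R) 0
  (flatten (nseq k [:: e; 0])) 0 [::].
rewrite addr0 /= => ->; rewrite -[leLHS](walk_mean_cst N N_gt0 (n - k.*2) 1 0 [::]).
apply: walk_mean_le => y g _; rewrite (_ : (b <= _) = true)//.
apply: le_trans bk _; apply: le_trans (powq_count_le q 0 _ q1); apply: powq_le => //.
rewrite count_cat; apply: leq_trans (leq_addl _ _).
elim: k {kn} => //= k IH; rewrite eqxx; lia.
Qed.

End LowerTail.

(** * Upper limits, the lower tail and the conclusion *)

Lemma limf_esup_le (R : realType) (X : choiceType) (Y : filteredType X) (f : Y -> \bar R)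
    (F : set_system Y) (l : \bar R) :
  F [set x | (f x <= l)%E] -> (limf_esup f F <= l)%E.
Proof.
move=> Fl; rewrite limf_esupE.
apply: (@le_trans _ _ (ereal_sup (f @` [set x | (f x <= l)%E]))).
  by apply: ereal_inf_lbound; exists [set x | (f x <= l)%E].
by apply: ge_ereal_sup => _ [x /= xl <-].
Qed.
Lemma ereal_eqNy (R : realType) (x : \bar R) : (forall M, (x <= M%:E)%E) -> x = -oo%E.
Proof.
case: x => [r h|h|//].
  by have := h (r - 1)%R; rewrite lee_fin => hr; exfalso; lra.
by have := h 0%R.
Qed.

(** With [rho = 2/d], the condition [q > d/(d - 2)] is exactly [q (1 - rho) > 1]. *)
Lemma walk_constants (R : realType) (d : nat) (q : R) : (3 <= d)%N ->
  d%:R / (d%:R - 2) < q ->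
  exists rho CG : R, [/\ 0 <= rho, rho < 1, 1 <= CG, 1 < q * (1 - rho) &
    forall m x (s : seq 'rV[int]_d), uniq s ->
      \sum_(z <- s) green (lattice_steps d) m (x - z) <= CG * (size s)%:R `^ rho].
Proof.
move=> hd hq; have dR : 3 <= d%:R :> R by rewrite (ler_nat _ 3).
have [CG CG1 HG] := green_sum_le R d hd.
exists (2 / d%:R), CG; split => //.
- by rewrite ltr_pdivrMr; lra.
have -> : q * (1 - 2 / d%:R) = q * (d%:R - 2) / d%:R by field; lra.
rewrite ltr_pdivlMr; last lra.
by rewrite mul1r -ltr_pdivrMr//; lra.
Qed.

Lemma norm_pow_lower_tail (R : realType) (d : nat) (q : R) : (3 <= d)%N ->
  d%:R / (d%:R - 2) < q ->
  exists2 cm : R, 0 < cm & forall xi, 1 <= xi -> exists n0, forall n, (n0 <= n)%N ->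
    expR (- cm * (xi * n%:R) `^ q^-1) <=
    walk_mean (lattice_steps d) n (fun _ h =>
      (walk_mean (lattice_steps d) n (fun _ h => norm_pow q h) 0 [::] + xi * n%:R <=
       norm_pow q h)%R%:R) 0 [::] :> R.
Proof.
move=> hd hq; have [rho [CG [rho0 rho1 CG1 sup HG]]] := walk_constants R d q hd hq.
set N := lattice_steps d.
have N0 : (0 < size N)%N by rewrite size_lattice_steps; lia.
have q1 : 1 < q.
  have r1 : 0 < 1 - rho by rewrite subr_gt0.
  have q0 : 0 < q by rewrite -(pmulr_lgt0 _ r1) (lt_trans _ sup).
  by apply: lt_le_trans sup _; rewrite ler_piMr ?(ltW q0)// gerBl.
have q0 : 0 < q by exact: lt_trans q1.
have [C C0 HC] := norm_pow_mean_le N rho CG q N0 CG1 HG (ltW q1).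
(* With [k >= K tau] visits to 0 the norm is at least [(C + 1) xi n], which covers both the mean, at
   most [C n], and the excess [xi n]. *)
pose K := (C + 1) `^ q^-1; have K0 : 0 < K by rewrite powR_gt0// addr_gt0.
pose L : R := ln (size N)%:R.
have L0 : 0 < L by rewrite ln_gt0// (ltr_nat _ 1) size_lattice_steps; lia.
(* Each of the [2k] forced steps costs [expR (- L)], and rounding up gives [k <= (K + 1) tau]
   because [tau >= 1]. *)
exists (2 * (K + 1) * L); first by rewrite !mulr_gt0// addr_gt0.
move=> xi xi1; have xi0 : 0 < xi by exact: lt_le_trans xi1.
have qi0 : 0 <= q^-1 by rewrite invr_ge0 ltW.
have qi1 : q^-1 < 1 by rewrite invf_lt1.
have [n1 h1] := powR_eventually 1 q^-1 1 (2 * (K + 1) * xi `^ q^-1) qi0 qi1 ltr01.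
exists (maxn 1 n1) => n; rewrite geq_max => /andP[n_gt0 /h1].
have nR : 1 <= n%:R :> R by rewrite ler1n.
have nR0 : 0 < n%:R :> R by exact: lt_le_trans nR.
rewrite mul1r powRr1 ?(ltW nR0)// -mulrA -powRM ?(ltW xi0) ?(ltW nR0)//.
set tau := (xi * n%:R) `^ q^-1 => n_large.
have tau1 : 1 <= tau.
  have -> : 1 = 1 `^ q^-1 :> R by rewrite powR1.
  apply: ge0_ler_powR; rewrite ?nnegrE ?mulr_ge0 ?(ltW xi0)//.
  by rewrite -[leLHS]mulr1 ler_pM.
have tau0 : 0 < tau by exact: lt_le_trans tau1.
have tauq : tau `^ q = xi * n%:R.
  by rewrite /tau -powRrM mulVf ?gt_eqF// powRr1// mulr_ge0// ltW.
pose k := (Num.truncn (K * tau)).+1.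
have kle : k%:R <= (K + 1) * tau.
  have : (Num.truncn (K * tau))%:R <= K * tau by rewrite truncn_le// mulr_ge0 ?(ltW K0)// ltW.
  by rewrite /k -natr1; lra.
have kge : K * tau <= k%:R by apply/ltW; exact: truncnS_gt.
have kn : (k.*2 <= n)%N.
  by rewrite -(ler_nat R) -muln2 natrM; move: kle n_large; move: (k%:R) => kk; lra.
have c0 : 'I_d by case: d hd {hq HG N N0 L L0 HC} => // d' _; exact: ord0.
apply: le_trans (norm_pow_prob_ge N N0 q _ (delta_mx ord0 c0) k n (ltW q1) _ _ kn _); last 3 first.
- by rewrite mem_cat map_f ?mem_index_enum.
- by rewrite mem_cat orbC; apply/orP; left; rewrite (map_f (fun c => - delta_mx ord0 c))
  ?mem_index_enum.
- apply: (@le_trans _ _ ((C + 1) * (xi * n%:R))).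
    rewrite mulrDl mul1r lerD2r; apply: le_trans (HC n 0) _.
    by rewrite ler_wpM2l ?(ltW C0)// ler_peMl// ltW.
  have -> : (C + 1) * (xi * n%:R) = (K * tau) `^ q.
    rewrite powRM ?(ltW K0) ?(ltW tau0)// tauq /K -powRrM mulVf ?gt_eqF// powRr1//.
    by rewrite addr_ge0// ltW.
  by apply: ge0_ler_powR; rewrite ?nnegrE ?(ltW q0)// mulr_ge0 ?(ltW K0)// ltW.
have sN : 0 < (size N)%:R :> R by rewrite ltr0n.
have -> : (size N)%:R^-1 = expR (- L) by rewrite expRN lnK.
rewrite -expRM_natl ler_expR mulrN mulNr lerN2 -muln2 natrM.
have := ler_wpM2r (ltW L0) kle; move: (k%:R : R) => kk; lra.
Qed.

Theorem theorem1p2 (R : realType) (d : nat) (q : R) (hd : (3 <= d)%N)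
    (hq : d%:R / (d%:R - 2) < q) :
  (exists cm cp : R, [/\ 0 < cm, 0 < cp &
    forall (disp : measure_display) (T : measurableType disp)
      (P : probability T R) (S : nat -> T -> 'rV[int]_d),
    simple_random_walk P S ->
    forall xi : R, 1 <= xi ->
    \forall n \near \oo,
      let p := P [set w | ((norm_q_pow S q n w)%:E - 'E_P[norm_q_pow S q n]
                           >= (xi * n%:R)%:E)%E] in
      ((expR (- cm * (xi * n%:R) `^ q^-1))%:E <= p)%E /\
      (p <= (expR (- cp * (xi * n%:R) `^ q^-1))%:E)%E]) /\
  (forall (disp : measure_display) (T : measurableType disp)
      (P : probability T R) (S : nat -> T -> 'rV[int]_d),
    simple_random_walk P S ->
    forall xi : R, 1 <= xi ->
    limf_esup (fun eps : R =>
      limn_esup (fun n : nat =>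
        ((n%:R `^ q^-1)^-1)%:E *
        lne (P [set w | ((low_norm_q_pow S q (eps * n%:R `^ q^-1) n w)%:E
                         >= 'E_P[norm_q_pow S q n] + (xi * n%:R)%:E)%E]))%E)
      0^'+ = -oo%E).
Proof.
have [rho [CG [rho0 rho1 CG1 sup HG]]] := walk_constants R d q hd hq.
have d0 : (0 < d)%N by lia.
have N0 : (0 < size (lattice_steps d))%N by rewrite size_lattice_steps double_gt0.
have r1 : 0 < 1 - rho by rewrite subr_gt0.
have q0 : 0 < q by rewrite -(pmulr_lgt0 _ r1) (lt_trans _ sup).
have qn0 : q != 0 by rewrite gt_eqF.
pose E n : R := walk_mean (lattice_steps d) n (fun _ h => norm_pow q h) 0 [::].
split.
  have [cm cm0 lower] := norm_pow_lower_tail R d q hd hq.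
  have [cp cp0 upper] := norm_pow_upper_tail _ rho CG q N0 rho0 rho1 CG1 HG sup.
  exists cm, cp; split => // disp T P S SRW xi xi1.
  have [n1 h1] := lower xi xi1; have [n2 h2] := upper xi xi1.
  exists (maxn n1 n2) => // n /=; rewrite geq_max => /andP[/h1 {}h1 /h2 {}h2].
  rewrite (mean_norm_q_pow P d S SRW d0 q n qn0) -/(E n).
  have -> : [set w | ((xi * n%:R)%:E <= (norm_q_pow S q n w)%:E - (E n)%:E)%E] =
      [set w | E n + xi * n%:R <= norm_pow q (history d S n w)].
    apply/seteqP; split => w /=; rewrite (norm_q_powE d S q n w qn0) -EFinB lee_fin lerBrDl//.
  by rewrite (prob_history P d S SRW d0 (fun _ h => E n + xi * n%:R <= norm_pow q h)) !lee_fin.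
move=> disp T P S SRW xi xi1; apply: ereal_eqNy => M0.
have [e0 e00 tail] := low_pow_upper_tail _ rho CG q N0 rho0 rho1 CG1 HG sup xi (- M0) xi1.
apply: limf_esup_le; near=> eps.
have [n0 h0] : exists n0, forall n, (n0 <= n)%N -> walk_mean (lattice_steps d) n
    (fun _ h => (E n + xi * n%:R <=
      occ_sum (fun _ v => if v%:R < eps * n%:R `^ q^-1 then powq q v else 0) h)%R%:R) 0 [::]
    <= expR (- (- M0 * n%:R `^ q^-1)) :> R.
  by apply: tail; apply/andP; split; near: eps; [exact: nbhs_right_gt|exact: nbhs_right_lt].
apply: limf_esup_le; exists (maxn 1 n0) => // n /=; rewrite geq_max => /andP[n_gt0 /h0 {}h0].
have nu0 : 0 < n%:R `^ q^-1 :> R by rewrite powR_gt0// ltr0n.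
rewrite (mean_norm_q_pow P d S SRW d0 q n qn0) -/(E n).
have -> : [set w | ((E n)%:E + (xi * n%:R)%:E <= (low_norm_q_pow S q (eps * n%:R `^ q^-1) n
  w)%:E)%E] =
    [set w | E n + xi * n%:R <= occ_sum (fun _ v => if v%:R < eps * n%:R `^ q^-1 then powq q v
      else 0)
      (history d S n w)].
  by apply/seteqP; split => w /=; rewrite (low_norm_q_powE d S q _ n w qn0) -EFinD lee_fin.
rewrite (prob_history P d S SRW d0 (fun _ h => E n + xi * n%:R <=
  occ_sum (fun _ v => if v%:R < eps * n%:R `^ q^-1 then powq q v else 0) h)).
set p := walk_mean _ _ _ _ _ in h0 *.
(* A vanishing probability has logarithm [-oo], and the positive factor [n^(-1/q)] preserves it. *)
have [p0|p0] := leP p 0.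
  rewrite le0_lneNy ?lee_fin// gt0_muleNy ?leNye// lte_fin invr_gt0//.
rewrite lne_EFin// -EFinM lee_fin ler_pdivrMl// mulrC.
rewrite -(opprK (M0 * _)) -mulNr -ler_expR lnK//.
Unshelve. all: by end_near.
Qed.
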